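(* Let $T$ be a finite tree with vertex set $V=\{X_1,\ldots,X_d\}$, let $\mathbb{K}$ be a field, let $R=\mathbb{K}[X_1,\ldots,X_d]$, and let $N_T\subseteq R$ be the closed neighborhood ideal of $T$. The following conditions are equivalent: (i) $T$ is domination-unmixed; (ii) $N_T$ is unmixed; (iii) $N_T$ is Cohen-Macaulay; (iv) $N_T$ is a complete intersection. In particular, the Cohen-Macaulay property for $N_T$ is independent of the characteristic of $\mathbb{K}$.
   Context: All graphs are finite and simple (no loops, no multi-edges); an edge between distinct vertices $X_i,X_j$ is written $X_iX_j$. The vertices $X_1,\ldots,X_d$ of $T$ are also the variables of $R$. The closed neighborhood of a vertex $X_i$ is $N(X_i)=\{X_j\mid X_iX_j\text{ is an edge}\}\cup\{X_i\}$, its closed neighborhood monomial is $S_i=\prod_{X_j\in N(X_i)}X_j\in R$, and the closed neighborhood ideal of $T$ is $N_T=(S_1,\ldots,S_d)R$. A dominating set is a subset $V'\subseteq V$ such that $V'\cap N(X_i)\neq\emptyset$ for every $X_i\in V$; it is minimal if it does not properly contain another dominating set. A graph is domination-unmixed if all its minimal dominating sets have the same size. An ideal $I\subseteq R$ is unmixed if all associated primes of $R/I$ have the same height, is Cohen-Macaulay if the quotient ring $R/I$ is Cohen-Macaulay, and is a complete intersection if it is generated by an $R$-regular sequence. *)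

(* Defs.v *)
From HB Require Import structures.
From mathcomp Require Export all_boot all_algebra.
From mathcomp Require Export ring_quotient generic_quotient.
From mathcomp Require Export mpoly.
From mathcomp Require Import ring boolp.

Set Implicit Arguments.
Unset Strict Implicit.
Unset Printing Implicit Defensive.

Import GRing.Theory.
Local Open Scope ring_scope.
Local Open Scope quotient_scope.

(* Subsets of a ring are boolean predicates, as in ring_quotient; every
   proposition is reflected by a boolean through asbool, so no decidability
   restriction results. In that library [idealr] and [prime_idealr] are the
   types of proper ideals and of prime ideals. *)

Section IdealsAndRegularSequences.
Variable A : comNzRingType.
Implicit Types (s : seq A) (P : prime_idealr A).

Definition ideal_span s : {pred A} :=
  fun a => `[< exists c : nat -> A, a = \sum_(i < size s) c i * s`_i >].

Definition regular_sequence s : Prop :=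
  (forall i, (i < size s)%N -> forall a,
     s`_i * a \in ideal_span (take i s) -> a \in ideal_span (take i s))
  /\ 1 \notin ideal_span s.

Definition is_maximum (S : nat -> Prop) (n : nat) : Prop :=
  S n /\ forall m, S m -> (m <= n)%N.

(* p 0 < p 1 < ... < p n; the values of p beyond n play no role. *)
Definition prime_chain (p : nat -> prime_idealr A) (n : nat) : Prop :=
  forall i, (i < n)%N ->
    {subset p i <= p i.+1} /\ ~ {subset p i.+1 <= p i}.

Definition height P : nat -> Prop :=
  is_maximum (fun n => exists2 p, prime_chain p n & p n =i P).

Definition krull_dim : nat -> Prop :=
  is_maximum (fun n => exists p, prime_chain p n).

Definition depth (M : {pred A}) : nat -> Prop :=
  is_maximum (fun n => exists s,
    [/\ size s = n, {subset s <= M} & regular_sequence s]).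

Definition maximal_ideal (M : idealr A) : Prop :=
  forall J : idealr A, {subset M <= J} -> J =i M.

End IdealsAndRegularSequences.

(* The localization of A at the prime P. The equivalence relation of fractions
   has the extra factor t since A may have zero divisors. *)
Section LocalizationDef.
Variables (A : comNzRingType) (P : prime_idealr A).

Record lfrac := LFrac { lfrac_val :> A * A; _ : lfrac_val.2 \notin P }.
HB.instance Definition _ := [isSub for lfrac_val].
HB.instance Definition _ := [Choice of lfrac by <:].

Implicit Types x y z : lfrac.

Lemma lfrac_denP x : x.2 \notin P. Proof. by case: x. Qed.

Lemma notin_prime1 : 1 \notin P. Proof. by rewrite idealr1. Qed.

Lemma notin_primeM (a b : A) : a \notin P -> b \notin P -> a * b \notin P.
Proof. by move=> aP bP; rewrite prime_idealrM negb_or aP bP. Qed.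

Definition loc_equiv x y : bool :=
  `[< exists2 t : A, t \notin P & t * (x.1 * y.2) = t * (y.1 * x.2) >].

Lemma loc_equiv_refl : reflexive loc_equiv.
Proof. by move=> x; apply/asboolP; exists 1; rewrite ?notin_prime1. Qed.

Lemma loc_equiv_sym : ssrbool.symmetric loc_equiv.
Proof.
by move=> x y; apply/asboolP/asboolP => -[t tP e]; exists t.
Qed.

Lemma loc_equiv_trans : transitive loc_equiv.
Proof.
move=> y x z /asboolP[t tP et] /asboolP[u uP eu]; apply/asboolP.
exists (t * u * y.2); first by rewrite !notin_primeM ?lfrac_denP.
have -> : t * u * y.2 * (x.1 * z.2) = t * (x.1 * y.2) * (u * z.2) by ring.
have -> : t * u * y.2 * (z.1 * x.2) = u * (z.1 * y.2) * (t * x.2) by ring.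
by rewrite et -eu; ring.
Qed.

Canonical loc_equiv_equiv :=
  EquivRel loc_equiv loc_equiv_refl loc_equiv_sym loc_equiv_trans.

Definition localization := {eq_quot loc_equiv}.
HB.instance Definition _ := EqQuotient.on localization.
HB.instance Definition _ := Choice.on localization.

Lemma loc_eqP x y :
  reflect (exists2 t : A, t \notin P & t * (x.1 * y.2) = t * (y.1 * x.2))
          (x == y %[mod localization]).
Proof. by rewrite eqmodE; apply: asboolP. Qed.

Lemma loc_reprP x : exists2 t : A, t \notin P &
  t * ((repr (\pi_localization x)).1 * x.2)
    = t * (x.1 * (repr (\pi_localization x)).2).
Proof. by apply/loc_eqP; rewrite reprK. Qed.

Definition loc_zero : localization :=
  \pi_localization (@LFrac (0, 1) notin_prime1).
Definition loc_one : localization :=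
  \pi_localization (@LFrac (1, 1) notin_prime1).

Definition lfrac_add x y : lfrac :=
  @LFrac (x.1 * y.2 + y.1 * x.2, x.2 * y.2)
         (notin_primeM (lfrac_denP x) (lfrac_denP y)).
Definition lfrac_opp x : lfrac := @LFrac (- x.1, x.2) (lfrac_denP x).
Definition lfrac_mul x y : lfrac :=
  @LFrac (x.1 * y.1, x.2 * y.2) (notin_primeM (lfrac_denP x) (lfrac_denP y)).

Definition loc_add := lift_op2 localization lfrac_add.
Definition loc_opp := lift_op1 localization lfrac_opp.
Definition loc_mul := lift_op2 localization lfrac_mul.

Lemma pi_loc_add : {morph \pi : x y / lfrac_add x y >-> loc_add x y}.
Proof.
move=> x y; unlock loc_add; apply/eqP/loc_eqP => /=.
have [t tP et] := loc_reprP x; have [u uP eu] := loc_reprP y.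
set x' := repr _ in et *; set y' := repr _ in eu *.
exists (t * u); first exact: notin_primeM.
transitivity (t * (x.1 * x'.2) * (u * y.2 * y'.2)
              + u * (y.1 * y'.2) * (t * x.2 * x'.2)); first by ring.
by rewrite -et -eu; ring.
Qed.
Canonical pi_loc_add_morph := PiMorph2 pi_loc_add.

Lemma pi_loc_opp : {morph \pi : x / lfrac_opp x >-> loc_opp x}.
Proof.
move=> x; unlock loc_opp; apply/eqP/loc_eqP => /=.
have [t tP et] := loc_reprP x; exists t => //.
by rewrite !mulNr !mulrN et.
Qed.
Canonical pi_loc_opp_morph := PiMorph1 pi_loc_opp.

Lemma pi_loc_mul : {morph \pi : x y / lfrac_mul x y >-> loc_mul x y}.
Proof.
move=> x y; unlock loc_mul; apply/eqP/loc_eqP => /=.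
have [t tP et] := loc_reprP x; have [u uP eu] := loc_reprP y.
set x' := repr _ in et *; set y' := repr _ in eu *.
exists (t * u); first exact: notin_primeM.
transitivity (t * (x.1 * x'.2) * (u * (y.1 * y'.2))); first by ring.
by rewrite -et -eu; ring.
Qed.
Canonical pi_loc_mul_morph := PiMorph2 pi_loc_mul.

Ltac loc_ring :=
  rewrite ?piE; apply/eqP/loc_eqP; exists 1; [exact: notin_prime1 | move=> /=; ring].

Lemma loc_addA : associative loc_add.
Proof. by elim/quotW=> x; elim/quotW=> y; elim/quotW=> z; loc_ring. Qed.

Lemma loc_addC : commutative loc_add.
Proof. by elim/quotW=> x; elim/quotW=> y; loc_ring. Qed.

Lemma loc_add0 : left_id loc_zero loc_add.
Proof. by elim/quotW=> x; rewrite /loc_zero; loc_ring. Qed.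

Lemma loc_addN : left_inverse loc_zero loc_opp loc_add.
Proof. by elim/quotW=> x; rewrite /loc_zero; loc_ring. Qed.

HB.instance Definition _ :=
  GRing.isZmodule.Build localization loc_addA loc_addC loc_add0 loc_addN.

Lemma loc_mulA : associative loc_mul.
Proof. by elim/quotW=> x; elim/quotW=> y; elim/quotW=> z; loc_ring. Qed.

Lemma loc_mulC : commutative loc_mul.
Proof. by elim/quotW=> x; elim/quotW=> y; loc_ring. Qed.

Lemma loc_mul1 : left_id loc_one loc_mul.
Proof. by elim/quotW=> x; rewrite /loc_one; loc_ring. Qed.

Lemma loc_mulDl : left_distributive loc_mul loc_add.
Proof. by elim/quotW=> x; elim/quotW=> y; elim/quotW=> z; loc_ring. Qed.

Lemma loc_one_neq0 : loc_one != loc_zero.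
Proof.
apply/negP => /loc_eqP[t tP] /=.
by rewrite !mulr1 mulr0 => t0; move: tP; rewrite t0 idealr0.
Qed.

HB.instance Definition _ := GRing.Zmodule_isComNzRing.Build localization
  loc_mulA loc_mulC loc_mul1 loc_mulDl loc_one_neq0.

End LocalizationDef.

(* All the rings to which this is applied are Noetherian, being localizations
   of quotients of polynomial rings over a field; so the depth and the
   dimension below are finite. B is meant to be local: M is then its only
   maximal ideal. *)
Definition cohen_macaulay_local (B : comNzRingType) : Prop :=
  forall M : idealr B, maximal_ideal M ->
    exists2 n : nat, depth M n & krull_dim B n.

(* A maximal ideal is prime, so quantifying over the maximal ideals among the
   bundled prime ideals loses none of them. *)
Definition cohen_macaulay (A : comNzRingType) : Prop :=
  forall M : prime_idealr A, maximal_ideal M ->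
    cohen_macaulay_local (localization M).

Section IdealProperties.
Variables (R : comNzRingType) (I : idealr R).

(* P is the annihilator in R of an element of R/I. *)
Definition associated_prime (P : prime_idealr R) : Prop :=
  exists x : {ideal_quot I},
    forall a : R, (a \in P) = (\pi_({ideal_quot I}) a * x == 0).

Definition unmixed : Prop :=
  forall P Q : prime_idealr R, associated_prime P -> associated_prime Q ->
    forall h : nat, height P h <-> height Q h.

Definition cohen_macaulay_ideal : Prop := cohen_macaulay {ideal_quot I}.

Definition complete_intersection : Prop :=
  exists2 s : seq R, regular_sequence s & I =i ideal_span s.

End IdealProperties.

(* The vertex X_(i+1) of a graph on d vertices is i : 'I_d. *)
Section Graphs.
Variables (d : nat) (T : rel 'I_d).

Definition simple_graph : Prop := ssrbool.symmetric T /\ irreflexive T.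

(* A ucycle without repeated vertices is allowed to have length 2 (an edge
   travelled back and forth); genuine cycles have length at least 3. *)
Definition acyclic : Prop :=
  forall c : seq 'I_d, ucycle T c -> (size c < 3)%N.

Definition tree : Prop :=
  [/\ (0 < d)%N, simple_graph, forall i j, connect T i j & acyclic].

Definition closed_nbhd (i : 'I_d) : {set 'I_d} := [set j | T i j || (j == i)].

Definition dominating (D : {set 'I_d}) : bool :=
  [forall i, D :&: closed_nbhd i != set0].

Definition domination_unmixed : Prop :=
  forall D E : {set 'I_d},
    minset dominating D -> minset dominating E -> #|D| = #|E|.

End Graphs.

Section ClosedNeighborhoodIdeal.
Variables (K : fieldType) (d : nat) (T : rel 'I_d).

Definition closed_nbhd_monomial (i : 'I_d) : {mpoly K[d]} :=
  \prod_(j in closed_nbhd T i) 'X_j.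

Definition closed_nbhd_ideal : {pred {mpoly K[d]}} :=
  ideal_span [seq closed_nbhd_monomial i | i <- enum 'I_d].

Lemma closed_nbhd_ideal_closed : idealr_closed closed_nbhd_ideal.
Proof.
rewrite /closed_nbhd_ideal; split.
- by apply/asboolP; exists (fun=> 0); rewrite big1 // => i _; rewrite mul0r.
- apply/negP => /asboolP[c /(congr1 (meval (fun=> 0)))].
  rewrite meval1 raddf_sum big1 => [/eqP|i _]; first by rewrite oner_eq0.
  have: [seq closed_nbhd_monomial i | i <- enum 'I_d]`_i
          \in [seq closed_nbhd_monomial i | i <- enum 'I_d] by exact: mem_nth.
  case/mapP => k _ ->; rewrite /= mevalM /closed_nbhd_monomial.
  by rewrite (bigD1 k) ?inE ?eqxx ?orbT //= mevalM mevalXU mul0r mulr0.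
move=> a u v /asboolP[c ->] /asboolP[c' ->]; apply/asboolP.
exists (fun i => a * c i + c' i); rewrite mulr_sumr -big_split /=.
by apply: eq_bigr => i _; rewrite mulrDl mulrA.
Qed.

HB.instance Definition _ :=
  isIdealr.Build {mpoly K[d]} closed_nbhd_ideal closed_nbhd_ideal_closed.

End ClosedNeighborhoodIdeal.

Arguments closed_nbhd_monomial K {d} T i.
Arguments closed_nbhd_ideal K {d} T.

(* Main.v *)
(* In a forest, a greedy choice produces a dominating set that is no larger than
   some family of pairwise disjoint closed neighborhoods. If all minimal
   dominating sets have the same size, each of them therefore meets every member
   of that family exactly once and lies in their union. As every vertex, and
   every pair of neighbors of a vertex, lies in a minimal dominating set, the
   members of the family have at most two elements and cover the graph. So [N_T]
   is generated by monomials in disjoint sets of variables, of the form [X_l] or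
   [X_l * X_p].
   - Such an ideal is a complete intersection. It is Cohen-Macaulay: modulo
     [X_l * X_p], the polynomial ring is free over the polynomials in
     [z_l = X_l - X_p], and a maximal ideal contains a monic polynomial in each
     [z_l] (Zariski's lemma), so that these form a regular sequence.
   - Conversely, the associated primes of [N_T] are generated by the variables in
     the minimal dominating sets [D], and have height [#|D|]. If [N_T] is
     Cohen-Macaulay at the origin, its depth is at most [d - #|D|] for each [D],
     while its dimension is at least [d - #|D|]. If [N_T] is generated by a regular
     sequence, its length is [#|D|]: it is at least [#|D|] by the Jacobian
     criterion, and at most the height.
   All bounds on dimension and depth come from one elementary fact, due to Coquand
   and Lombardi: [d + 1] polynomials in [d] variables satisfy a relation of the
   form given by [collapses]. *)

Require Import Defs.
From HB Require Import structures.
From mathcomp Require Import ring boolp.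

Set Implicit Arguments.
Unset Strict Implicit.
Unset Printing Implicit Defensive.

(** * Dominating sets in forests *)

Section Trees.
Variables (d : nat) (T : rel 'I_d).
Hypotheses (Tsym : ssrbool.symmetric T) (Tirr : irreflexive T).

Lemma closed_nbhdxx i : i \in closed_nbhd T i.
Proof. by rewrite inE eqxx orbT. Qed.

Lemma closed_nbhd_sym i j : (i \in closed_nbhd T j) = (j \in closed_nbhd T i).
Proof. by rewrite !inE Tsym eq_sym. Qed.

Lemma dominatingP (D : {set 'I_d}) :
  reflect (forall i, exists2 j, j \in D & j \in closed_nbhd T i)
          (dominating T D).
Proof.
apply: (iffP forallP) => D_dom i.
  by have /set0Pn[j /setIP[]] := D_dom i; exists j.
by have [j jD ji] := D_dom i; apply/set0Pn; exists j; rewrite inE jD.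
Qed.

(** Otherwise every vertex of [S] has two neighbors in [S], and a path in [S] can be prolonged at
    its head without end, since acyclicity keeps it from meeting itself. It then outgrows the [d]
    vertices. *)
Lemma acyclic_leaf (S : {set 'I_d}) : acyclic T -> S != set0 ->
  exists2 v, v \in S & {in S &, forall a b, T v a -> T v b -> a = b}.
Proof.
move=> Tacyc /set0Pn[x0 x0S]; apply: contrapT => noleaf.
have two v : v \in S -> forall y, exists2 c, c \in S & T v c /\ c != y.
  move=> vS y; apply: contrapT => noc; case: noleaf; exists v => // a b aS bS.
  have neq c : c \in S -> T v c -> c = y.
    by move=> cS vc; apply: contrapT => /eqP cy; case: noc; exists c.
  by move=> va vb; rewrite (neq a aS va) (neq b bS vb).
have long n : exists x p,
    [/\ size p = n, uniq (x :: p), path T x p & {subset x :: p <= S}].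
  elim: n => [|n [x [p [sp up pp pS]]]].
    by exists x0, [::]; split=> // y; rewrite inE => /eqP->.
  have xS : x \in S by apply: pS; rewrite inE eqxx.
  have [c cS [xc c_neq]] := two x xS (head x p).
  have cx : c != x by apply: contraTneq xc => ->; rewrite Tirr.
  have [cp|cp] := boolP (c \in p); last first.
    exists c, (x :: p); split; first by rewrite /= sp.
    - by rewrite cons_uniq up inE negb_or cx cp.
    - by rewrite /= Tsym xc.
    - by move=> y; rewrite inE => /predU1P[->|/pS].
  (* A vertex [c] already on the path closes it up to a cycle, of length at least 3 because [c] is
     not the vertex next to [x]. *)
  case/splitPr: p / cp c_neq pp up sp pS => p1 p2 c_neq.
  rewrite -cat_rcons cat_path => /andP[pp _].
  rewrite -cat_cons cat_uniq => /andP[up _] _ _.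
  have /Tacyc : ucycle T (x :: rcons p1 c).
    by rewrite /ucycle up andbT /= rcons_path pp last_rcons Tsym.
  by case: (p1) c_neq => [|? ?] /=; rewrite ?eqxx // size_rcons.
have [x [p [sp up _ _]]] := long d.
by have := max_card (mem (x :: p)); rewrite (card_uniqP up) card_ord /= sp ltnn.
Qed.

(* Vertices are processed in an order such that each one, [w], has at most one
   neighbour [u] among the remaining ones, [S]: if [w] is not yet dominated,
   then [u] (or [w], if there is no [u]) is added to [D], and [w] to [P]. *)
Lemma greedy_packing : acyclic T -> exists D P : {set 'I_d},
  [/\ dominating T D, #|D| <= #|P| &
      {in P &, forall v w, v != w ->
         [disjoint closed_nbhd T v & closed_nbhd T w]}].
Proof.
move=> Tacyc.
(* The clause ending in [x \in D] keeps the packing disjoint: a neighbor of a member [v] of [P] that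
   is still in [S], or adjacent to [S], is in [D]. So a vertex of [S] not yet dominated has distance
   at least 3 from [v]. *)
suff greedy n : n <= d -> exists S D P : {set 'I_d},
  [/\ #|S| = d - n, #|D| <= #|P| &
    [/\ P \subset ~: S,
      {in ~: S, forall v, {in S &, forall a b, T v a -> T v b -> a = b}},
      {in ~: S, forall v, exists2 j, j \in D & j \in closed_nbhd T v},
      {in P, forall v x, T v x -> x \in S \/ (exists2 w, w \in S & T x w) ->
         x \in D} &
      {in P &, forall v w, v != w ->
         [disjoint closed_nbhd T v & closed_nbhd T w]}]].
  have [S [D [P [cS cDP [_ _ dom _ pack]]]]] := greedy d (leqnn d).
  exists D, P; split => //; apply/dominatingP => i; apply: dom.
  by move: cS; rewrite subnn => /cards0_eq ->; rewrite !inE.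
elim: n => [_|n IH ltnd].
  exists [set: 'I_d], set0, set0; rewrite cardsT card_ord subn0; split => //.
  by split; rewrite ?sub0set // => v; rewrite !inE.
have [S [D [P [cS cDP [PS one dom par pack]]]]] := IH (ltnW ltnd).
have [|w wS wleaf] := @acyclic_leaf S Tacyc.
  by rewrite -card_gt0 cS subn_gt0.
have inS' x : (x \in ~: (S :\ w)) = (x == w) || (x \in ~: S).
  by rewrite !inE negb_and negbK.
have one' : {in ~: (S :\ w), forall v,
    {in S :\ w &, forall a b, T v a -> T v b -> a = b}}.
  move=> v; rewrite inS' => /predU1P[->|vS] a b /setD1P[_ aS] /setD1P[_ bS].
    exact: wleaf.
  exact: one.
have cS' : #|S :\ w| = d - n.+1.
  by apply/eqP; rewrite subnS -cS (cardsD1 w S) wS.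
have PS' : P \subset ~: (S :\ w).
  by apply: subset_trans PS _; rewrite setCS subD1set.
have [/exists_inP[j jD jw]|undom] :=
    boolP [exists j in D, j \in closed_nbhd T w].
  exists (S :\ w), D, P; split => //; split => //.
    by move=> v; rewrite inS' => /predU1P[->|/dom//]; exists j.
  move=> v vP x vx [/setD1P[_ xS]|[u /setD1P[_ uS] xu]]; apply: (par v) => //.
    by left.
  by right; exists u.
have {}undom j : j \in D -> j \notin closed_nbhd T w.
  by move=> jD; apply: contra undom => jw; apply/exists_inP; exists j.
pose u := odflt w [pick u in S | T w u].
have uw : u \in closed_nbhd T w.
  by rewrite /u; case: pickP => [u' /andP[_ wu']|_] /=; rewrite inE ?wu' ?eqxx ?orbT.
have uP x : x \in S -> T w x -> x = u.
  move=> xS wx; rewrite /u; case: pickP => [u' /andP[u'S wu'] /=|/(_ x)].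
    exact: wleaf.
  by rewrite xS wx.
have wP : w \notin P.
  by apply/negP => /(subsetP PS); rewrite inE wS.
have newpack v : v \in P ->
    [disjoint closed_nbhd T v & closed_nbhd T w].
  move=> vP; have vS : v \in ~: S by exact: (subsetP PS).
  rewrite disjoint_subset; apply/subsetP => x xv; rewrite inE; apply/negP => xw.
  have wv : ~ T v w.
    by move=> vw; have := undom w (par _ vP _ vw (or_introl _ wS));
       rewrite closed_nbhdxx.
  move: (xv) (xw); rewrite !inE => /orP[vx|/eqP->]; last first.
    by rewrite Tsym => /orP[//|/eqP vw]; move: vS; rewrite vw inE wS.
  move=> /orP[wx|/eqP xw']; last by apply: wv; rewrite -xw'.
  have xD : x \in D by apply: (par _ vP _ vx); right; exists w; rewrite // Tsym.
  by have := undom x xD; rewrite xw.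
exists (S :\ w), (u |: D), (w |: P); split => //.
  rewrite !cardsU1 wP; apply: leq_add => //; exact: leq_b1.
split => //.
- by rewrite subUset PS' andbT sub1set inS' eqxx.
- move=> v; rewrite inS' => /predU1P[->|/dom[j jD jv]].
    by exists u => //; rewrite !inE eqxx.
  by exists j => //; rewrite inE jD orbT.
- move=> v /setU1P[->|vP] x vx.
    case=> [/setD1P[_ xS]|[y /setD1P[yw yS] xy]].
      by rewrite !inE (uP x) ?eqxx.
    have [xS|xS] := boolP (x \in S); first by rewrite !inE (uP x) ?eqxx.
    (* A processed [x] would have two neighbors in [S], namely [w] and [y]. *)
    by case/eqP: yw; apply: (one x) => //; rewrite ?inE // Tsym.
  move=> hx; rewrite inE orbC (par v) //.
  case: hx => [/setD1P[_ xS]|[y /setD1P[_ yS] xy]]; first by left.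
  by right; exists y.
- move=> v v' /setU1P[->|vP] /setU1P[->|v'P] vv'; first by rewrite eqxx in vv'.
  + by rewrite disjoint_sym; apply: newpack.
  + exact: newpack.
  + exact: pack.
Qed.

Definition independent (A : {set 'I_d}) := [forall i in A, forall j in A, ~~ T i j].

Lemma independentP (A : {set 'I_d}) :
  reflect {in A &, forall i j, ~~ T i j} (independent A).
Proof.
apply: (iffP forall_inP) => Aind i; first by move=> j /Aind/forall_inP; apply.
by move=> iA; apply/forall_inP => j; apply: Aind.
Qed.

(** A maximal independent set containing [A] will do: an undominated vertex could be added to it,
    and a vertex that is left out has no neighbor in the set to dominate it. *)
Lemma independent_minset (A : {set 'I_d}) : independent A ->
  exists2 D : {set 'I_d}, minset (dominating T) D & A \subset D.
Proof.
move=> Aind; have [D /maxsetP[Dind Dmax] AD] := maxset_exists Aind.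
exists D => //; apply/minsetP; split.
  apply/dominatingP => i; have [iD|iD] := boolP (i \in D).
    by exists i => //; apply: closed_nbhdxx.
  apply: contrapT => nodom; case/negP: iD.
  rewrite -(Dmax (i |: D)) ?subsetUr ?inE ?eqxx //.
  have noT j : j \in D -> ~~ T i j.
    by move=> jD; apply/negP => ij; case: nodom; exists j; rewrite // inE ij.
  apply/independentP => x y /setU1P[->|xD] /setU1P[->|yD].
  - by rewrite Tirr.
  - exact: noT.
  - by rewrite Tsym noT.
  - exact: (independentP _ Dind).
move=> E /dominatingP Edom ED; apply/eqP; rewrite eqEsubset ED.
apply/subsetP => x xD; have [y yE] := Edom x.
rewrite inE => /orP[xy|/eqP<- //].
by have /negP := independentP _ Dind x y xD (subsetP ED y yE).
Qed.

End Trees.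

Section Transversal.
Variables (V : finType) (N : V -> {set V}) (P : {set V}).
Hypothesis disjN : {in P &, forall v w, v != w -> [disjoint N v & N w]}.

Lemma disjoint_index x v w : v \in P -> w \in P -> x \in N v -> x \in N w -> v = w.
Proof.
move=> vP wP xv xw; apply/eqP; apply: contraT => /(disjN vP wP).
by move=> /disjointFr/(_ xv); rewrite xw.
Qed.

Lemma transversal_inj (f : V -> V) : {in P, forall v, f v \in N v} ->
  {in P &, injective f}.
Proof.
move=> fN v w vP wP eqf; apply: (@disjoint_index (f v)) => //; first exact: fN.
by rewrite eqf; exact: fN.
Qed.

Lemma transversal_exists (E : {set V}) :
  {in P, forall v, E :&: N v != set0} ->
  exists2 f : V -> V, {in P, forall v, f v \in N v} & f @: P \subset E.
Proof.
move=> hit; pose f v := odflt v [pick x in E :&: N v].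
have fP v : v \in P -> (f v \in E) && (f v \in N v).
  rewrite /f => /hit/set0Pn[x xEN]; case: pickP => [y|/(_ x)] /=.
    by rewrite inE.
  by rewrite xEN.
exists f => [v /fP/andP[]//|].
by apply/subsetP => _ /imsetP[v /fP/andP[fE _] ->].
Qed.

End Transversal.

(** * Packings by closed neighborhoods with at most two elements *)

Section StarPacking.
Variables (d : nat) (T : rel 'I_d).

(* In a tree with at least two vertices, [L] consists of leaves, [p] maps them
   to their neighbours, and every vertex that is not in [L] is adjacent to
   exactly one element of [L]. *)
Definition star_packing (L : {set 'I_d}) (p : 'I_d -> 'I_d) : Prop :=
  [/\ {in L, forall l, closed_nbhd T l = [set l; p l]},
      {in L &, forall l m, l != m ->
         [disjoint closed_nbhd T l & closed_nbhd T m]} &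
      forall i, exists2 l, l \in L &
        i \in closed_nbhd T l /\ closed_nbhd T l \subset closed_nbhd T i].

Hypotheses (Tsym : ssrbool.symmetric T) (Tirr : irreflexive T).

Lemma no_triangle i j k : acyclic T -> T i j -> T i k -> j != k -> ~~ T j k.
Proof.
move=> Tacyc ij ik jk; apply/negP => Tjk.
have := Tacyc [:: i; j; k]; rewrite /ucycle /= ij Tjk (Tsym k) ik !inE jk /= negb_or.
have neqT x y : T x y -> (x == y) = false.
  by move=> xy; apply/eqP => exy; rewrite exy Tirr in xy.
by rewrite !neqT //= => /(_ isT).
Qed.

(** All minimal dominating sets have at most [#|P|] elements, by comparison with one inside the
    greedy set [D]. As each meets every closed neighborhood of the packing, it is a transversal of
    the packing and nothing more. *)
Lemma unmixed_star_packing : acyclic T -> domination_unmixed T ->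
  exists L p, star_packing L p.
Proof.
move=> Tacyc unm; have [D [P [Ddom DP disj]]] := greedy_packing Tsym Tirr Tacyc.
have [D0 D0min D0D] := minset_exists Ddom.
have tr E : minset (dominating T) E ->
    exists2 f, {in P, forall v, f v \in closed_nbhd T v} & f @: P = E.
  move=> Emin; have [|f fN fE] := @transversal_exists _ (closed_nbhd T) P E.
    by move=> v _; case/minsetP: Emin => /forallP.
  exists f => //; apply/eqP; rewrite eqEcard fE card_in_imset.
    by rewrite (unm E D0) // (leq_trans (subset_leq_card D0D)).
  exact: (transversal_inj disj fN).
(* Two neighbors of [v] are not adjacent, so some minimal dominating set contains both; but a
   transversal has only one point in the closed neighborhood of [v]. *)
have nbr1 v a b : v \in P -> T v a -> T v b -> a = b.
  move=> vP va vb; apply/eqP; apply: contraT => ab.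
  have ind : independent T [set a; b].
    apply/independentP => i j /set2P[]-> /set2P[]->; rewrite ?Tirr //.
      exact: no_triangle Tacyc va vb ab.
    by apply: no_triangle Tacyc vb va _; rewrite eq_sym.
  have [E Emin abE] := independent_minset Tsym Tirr ind.
  have [f fN fE] := tr E Emin.
  have fv x : x \in E -> T v x -> x = f v.
    rewrite -fE => /imsetP[w wP ->] vx; congr f.
    apply: (disjoint_index disj wP vP (fN _ wP)).
    by rewrite inE vx.
  have aE : a \in E by rewrite (subsetP abE) // !inE eqxx.
  have bE : b \in E by rewrite (subsetP abE) // !inE eqxx orbT.
  by rewrite (fv a aE va) (fv b bE vb) eqxx in ab.
pose p l := odflt l [pick j | T l j].
have Np l : l \in P -> closed_nbhd T l = [set l; p l].
  move=> lP; apply/setP => j; rewrite !inE orbC /p.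
  case: pickP => [k lk|/(_ j)->] /=; last by rewrite orbb orbF.
  by congr orb; apply/idP/eqP => [lj|->//]; apply: (nbr1 l).
exists P, p; split => // i.
(* Some minimal dominating set contains [i]; being a transversal, it places [i] in the closed
   neighborhood of some [l]. So [i] is [l] or [p l], and is equal or adjacent to both. *)
have ind : independent T [set i].
  by apply/independentP => x y /set1P-> /set1P->; rewrite Tirr.
have [E Emin] := independent_minset Tsym Tirr ind; rewrite sub1set.
have [f fN <-] := tr E Emin; case/imsetP => l lP ifl.
have il : i \in closed_nbhd T l by rewrite ifl; apply: fN.
exists l => //; split => //; apply/subsetP => x.
rewrite (Np l lP) => /set2P[->|->].
  by rewrite closed_nbhd_sym.
move: il; rewrite (Np l lP) => /set2P[->|->]; last exact: closed_nbhdxx.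
by rewrite (Np l lP) !inE eqxx orbT.
Qed.

End StarPacking.

Import GRing.Theory.
Local Open Scope ring_scope.
Local Open Scope quotient_scope.

(** * Algebraic dependence of polynomials *)

Section Collapse.
Variable A : comNzRingType.
Implicit Types (J : {pred A}) (s t : seq A).

Definition ideal_closed J := forall a, {in J &, forall u v, a * u + v \in J}.

Definition regular_mod J x := forall a, x * a \in J -> a \in J.

(* The relation [x_1^k_1 (... (x_n^k_n (1 + c_n x_n) + ...) + c_1 x_1) = u]. *)
Fixpoint collapses s (u : A) : Prop :=
  if s is x :: s' then
    exists k c, exists2 v, collapses s' v & u = x ^+ k * (v + c * x)
  else u = 1.

(* Both a chain of primes and a regular sequence give rise to such a flag. *)
Inductive regular_flag : {pred A} -> seq A -> {pred A} -> Prop :=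
| regular_flag_nil J : regular_flag J [::] J
| regular_flag_cons J x J1 s J2 :
    regular_mod J x -> {subset J <= J1} -> x \in J1 -> ideal_closed J1 ->
    regular_flag J1 s J2 -> regular_flag J (x :: s) J2.

(** If [x ^+ k * (v + c * x)] lies in [J], regularity cancels the power of [x], and [v] lies in the
    next ideal because [x] does. At the end of a flag the relation thus puts 1 into the last
    ideal. *)
Lemma collapses_flag J s J1 t u :
  regular_flag J s J1 -> collapses (s ++ t) u -> u \in J ->
  exists2 v, v \in J1 & collapses t v.
Proof.
move=> fl; elim: fl u => [J' u|J' x J2 s' J3 reg sub xJ2 idJ2 _ IH u].
  by exists u.
move=> [k [c [v hv ->]]] uJ; apply: (IH v) => //.
have wJ : v + c * x \in J2.
  apply: sub; elim: k uJ => [|k IHk]; first by rewrite mul1r.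
  by rewrite exprS -mulrA => /reg.
have -> : v = - c * x + (v + c * x) by ring.
exact: idJ2.
Qed.

End Collapse.

Section Dimension.
Variables (K : fieldType) (d : nat).
Implicit Types (s : seq {mpoly K[d]}) (c : seq nat -> K).

(** [msize] is the degree plus one, and 0 for the zero polynomial; the successors make this the
    additivity of degree bounds, without a case for 0. *)
Lemma msizeM_leS (p q : {mpoly K[d]}) a b :
  (msize p <= a.+1 -> msize q <= b.+1 -> msize (p * q) <= (a + b).+1)%N.
Proof.
have [-> _ _|p0] := eqVneq p 0; first by rewrite mul0r msize0.
have [-> _ _|q0] := eqVneq q 0; first by rewrite mulr0 msize0.
rewrite msizeM // => pa qb; have := leq_add pa qb; rewrite addSn addnS.
by case: (_ + _)%N.
Qed.

Section Combination.
Variable N : nat.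

(** The value at [s] of the polynomial with coefficients [c], indexed by lists of exponents below
    [N]. A coefficient function, unlike a polynomial type, allows recursion on [s]. *)
Fixpoint combination s c : {mpoly K[d]} :=
  if s is x :: s' then
    \sum_(i < N) x ^+ i * combination s' (fun e => c (val i :: e))
  else (c [::])%:MP.

Lemma combination_linear (I : finType) s (a : I -> K) (c : I -> seq nat -> K) :
  combination s (fun e => \sum_k a k * c k e)
    = \sum_k a k *: combination s (c k).
Proof.
elim: s c => [|x s IH] c /=.
  by rewrite raddf_sum; apply: eq_bigr => k _; rewrite /= mpolyCM mul_mpolyC.
under eq_bigr do rewrite IH mulr_sumr.
rewrite exchange_big; apply: eq_bigr => k _ /=; rewrite scaler_sumr.
by apply: eq_bigr => i _; rewrite scalerAr.
Qed.

Definition exponents s (e : seq nat) := (size e == size s) && all (ltn^~ N) e.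

Lemma combination0 s c : (forall e, exponents s e -> c e = 0) ->
  combination s c = 0.
Proof.
elim: s c => [|x s IH] c c0 /=; first by rewrite c0 // mpolyC0.
rewrite big1 // => i _; rewrite IH ?mulr0 // => e /andP[se alle].
by apply: c0; rewrite /exponents /= eqSS se ltn_ord.
Qed.

(* The lexicographically smallest exponent with a nonzero coefficient gives
   the powers in [collapses]. *)
Lemma combination_collapses s c e : exponents s e -> c e != 0 ->
  exists2 k : K, k != 0 & collapses s (k%:MP * combination s c).
Proof.
elim: s c e => [|x s IH] c e.
  case/andP; case: e => // _ _ ce; exists (c [::])^-1; first by rewrite invr_eq0.
  by rewrite /= -mpolyCM mulVf.
move=> se ce; pose P i := `[< exists2 e, exponents s e & c (i :: e) != 0 >].
have [|i /asboolP[e' se' ce'] imin] := @ex_minnP P.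
  case: e se ce => // i e /andP[] /= se /andP[_ alle] ce; exists i.
  by apply/asboolP; exists e => //; rewrite /exponents -eqSS se.
have iN : (i < N)%N.
  case: e se ce => // j e /andP[] /= se /andP[jN alle] ce.
  apply: leq_ltn_trans jN; apply: imin; apply/asboolP; exists e => //.
  by rewrite /exponents -eqSS se.
have [k k0 col] := IH (fun e => c (i :: e)) _ se' ce'.
exists k => //=.
pose u j := combination s (fun e => c (j :: e)).
(* As [i] is the least first exponent that occurs, the sum is [x ^+ i * (u i + w * x)], where [w]
   gathers the higher powers of [x]. *)
pose w := \sum_(j < N | (i < j)%N) x ^+ (j - i.+1) * u j.
exists i, (k%:MP * w), (k%:MP * u i) => //.
have -> : \sum_(j < N) x ^+ j * combination s (fun e0 => c (val j :: e0))
   = x ^+ i * (u i + w * x); last by ring.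
rewrite (bigID (fun j : 'I_N => (i < j)%N)) /=.
rewrite [X in _ + X](bigD1 (Ordinal iN)) /= ?ltnn //.
rewrite [X in _ + (_ + X)]big1 => [|j]; last first.
  rewrite -leqNgt => /andP[ji neq]; rewrite combination0 ?mulr0 // => e1 se1.
  apply/eqP; apply: contraNT neq => ce1; rewrite -val_eqE /= eqn_leq ji.
  by apply: imin; apply/asboolP; exists e1.
rewrite addr0 mulrDr addrC; congr (_ + _).
rewrite mulrC -mulrA /w mulr_suml.
apply: eq_bigr => j ij; rewrite -/(u j).
have -> : x ^+ j = x ^+ (j - i.+1) * (x * x ^+ i) by rewrite -exprS -exprD subnK.
by ring.
Qed.

Lemma combination_msize s c D : {in s, forall x, msize x <= D.+1}%N ->
  (msize (combination s c) <= (size s * (N * D)).+1)%N.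
Proof.
elim: s c => [|x s IH] c sD /=; first by rewrite msizeC leq_b1.
have xD : (msize x <= D.+1)%N by apply: sD; rewrite inE eqxx.
apply: leq_trans (msize_sum _ _ _) _.
apply/bigmax_leqP_seq => i _ _; rewrite mulSn.
apply: msizeM_leS; last by apply: IH => y ys; apply: sD; rewrite inE ys orbT.
have : (msize (x ^+ i) <= (i * D).+1)%N.
  elim: (i : nat) => [|j IHj]; first by rewrite expr0 msize1.
  by rewrite exprS mulSn msizeM_leS.
by move/leq_trans; apply; rewrite ltnS leq_mul2r ltnW ?ltn_ord ?orbT.
Qed.

End Combination.

Lemma card_bmultinom_le B : (#|{: 'X_{1..d < B}}| <= B ^ d)%N.
Proof.
have lt (m : 'X_{1..d < B}) i : (m i < B)%N.
  by apply: leq_ltn_trans (bmdeg m); rewrite mdegE (bigD1 i) //= leq_addr.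
pose f (m : 'X_{1..d < B}) := [ffun i => Ordinal (lt m i)].
have /leq_card : injective f.
  move=> m m' /ffunP eqf; apply: val_inj; apply/mnmP => i.
  by have := eqf i; rewrite !ffunE => /(congr1 val).
by rewrite card_ffun !card_ord.
Qed.

(** By counting: the products of powers of [s] with exponents below [N] number [N ^ size s], but
    their degrees grow only linearly in [N], so they lie in a space of dimension at most [B ^ d].
    For large [N] they are linearly dependent. *)
Lemma long_seq_collapses s : (d < size s)%N -> collapses s 0.
Proof.
move=> ltds; pose D := \max_(x <- s) msize x.
have sD : {in s, forall x, msize x <= D.+1}%N.
  by move=> x xs; apply: leqW; apply: leq_bigmax_seq.
(* [B] exceeds every degree that occurs. From [B <= N * C] follows
   [B ^ d <= N ^ d * C ^ d < N ^ d.+1], which is why [N] is taken just above [C ^ d]. *)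
pose C := (size s * D).+1; pose N := (C ^ d).+1.
pose B := (size s * (N * D)).+1.
have ltBN : (B ^ d < N ^ size s)%N.
  apply: (@leq_trans (N ^ d.+1)); last by rewrite leq_pexp2l.
  have BN : (B <= N * C)%N by rewrite /B /C mulnS mulnCA -addn1 addnC leq_add2r.
  rewrite expnS mulnC; apply: (@leq_ltn_trans ((N * C) ^ d)).
    by have [->|d0] := posnP d; rewrite ?expn0 // leq_exp2r.
  by rewrite expnMn ltn_pmul2l ?expn_gt0 ?ltnSn.
(* Rows are exponent tuples and columns monomials of degree below [B]; a nonzero vector in the left
   kernel gives the coefficients of the relation. *)
pose M := \matrix_(i < #|{: (size s).-tuple 'I_N}|, j < #|{: 'X_{1..d < B}}|)
  (combination N s (fun e => ([seq val k | k <- enum_val i] == e)%:R))@_(enum_val j).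
have /rowV0Pn[v /sub_kermxP vM v0] : kermx M != 0.
  rewrite -mxrank_eq0 mxrank_ker subn_eq0 -ltnNge.
  apply: leq_ltn_trans (rank_leq_col M) _.
  by rewrite card_tuple card_ord; apply: leq_ltn_trans (card_bmultinom_le B) _.
pose c e := \sum_k v 0 k * ([seq val k | k <- enum_val k] == e)%:R.
have comb0 : combination N s c = 0.
  apply/mpolyP => m; rewrite mcoeff0.
  have [ltmB|leBm] := ltnP (mdeg m) B; last first.
    apply/eqP; rewrite mcoeff_eq0; apply: msize_mdeg_ge.
    by apply: leq_trans leBm; apply: combination_msize.
  have := congr1 (fun u : 'rV_ _ => u 0 (enum_rank (BMultinom ltmB))) vM.
  rewrite !mxE => <-; rewrite /c combination_linear raddf_sum.
  by apply: eq_bigr => k _; rewrite /= mcoeffZ mxE enum_rankK.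
have [i vi] : exists i, v 0 i != 0.
  by apply/existsP; apply: contraR v0 => /existsPn v0; apply/eqP/rowP => i;
     rewrite mxE; apply/eqP; rewrite -[_ == _]negbK.
have [||k _] := @combination_collapses N s c [seq val k | k <- enum_val i].
- by rewrite /exponents size_map size_tuple eqxx all_map; apply/allP => k _ /=.
- rewrite /c (bigD1 i) //= eqxx mulr1 big1 ?addr0 // => j ji.
  rewrite (inj_eq (inj_map val_inj)) (inj_eq val_inj) (inj_eq enum_val_inj).
  by rewrite (negPf ji) mulr0.
by rewrite comb0 mulr0.
Qed.

End Dimension.

(** * Ideals and coordinate primes *)

Section Spans.
Variable A : comNzRingType.
Implicit Types (J : {pred A}) (s t : seq A) (a x y : A).

Lemma ideal_closed0 J x : ideal_closed J -> x \in J -> 0 \in J.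
Proof. by move=> idJ xJ; rewrite -(addNr x) -mulN1r idJ. Qed.

Lemma ideal_closedM J a x : ideal_closed J -> x \in J -> a * x \in J.
Proof.
by move=> idJ xJ; rewrite -[a * x]addr0 idJ // (ideal_closed0 idJ xJ).
Qed.

Lemma ideal_closedD J x y : ideal_closed J -> x \in J -> y \in J -> x + y \in J.
Proof. by move=> idJ xJ yJ; rewrite -[x]mul1r idJ. Qed.

Lemma idealr_ideal_closed (J : idealr A) : ideal_closed J.
Proof. by move=> a u v uJ vJ; rewrite rpredD // idealMr. Qed.

Lemma ideal_spanP s a :
  reflect (exists c : nat -> A, a = \sum_(i < size s) c i * s`_i)
          (a \in ideal_span s).
Proof. exact: asboolP. Qed.

Lemma ideal_span_closed s : ideal_closed (ideal_span s).
Proof.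
move=> a u v /ideal_spanP[c ->] /ideal_spanP[c' ->]; apply/ideal_spanP.
exists (fun i => a * c i + c' i); rewrite mulr_sumr -big_split /=.
by apply: eq_bigr => i _; rewrite mulrDl mulrA.
Qed.

Lemma ideal_span0 s : 0 \in ideal_span s.
Proof.
by apply/(ideal_spanP s 0); exists (fun=> 0); rewrite big1 // => i _; rewrite mul0r.
Qed.

Lemma ideal_span_rcons s x a :
  reflect (exists c, a - c * x \in ideal_span s) (a \in ideal_span (rcons s x)).
Proof.
have sumE (c : nat -> A) : \sum_(i < size (rcons s x)) c i * (rcons s x)`_i
    = \sum_(i < size s) c i * s`_i + c (size s) * x.
  rewrite size_rcons big_ord_recr /= nth_rcons ltnn eqxx; congr (_ + _).
  by apply: eq_bigr => i _; rewrite nth_rcons ltn_ord.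
apply: (iffP (ideal_spanP _ _)) => [[c ->]|[c /ideal_spanP[c' def_a]]].
  exists (c (size s)); apply/ideal_spanP; exists c.
  by rewrite sumE addrK.
pose c2 i := if i == size s then c else c' i.
exists c2; rewrite (sumE c2) /c2 eqxx -(subrK (c * x) a) def_a; congr (_ + _).
by apply: eq_bigr => i _; rewrite ltn_eqF.
Qed.

Lemma mem_ideal_span s x : x \in s -> x \in ideal_span s.
Proof.
move=> /(nthP 0)[i lti <-]; apply/ideal_spanP.
exists (fun j => (j == i)%:R); rewrite (bigD1 (Ordinal lti)) //= eqxx mul1r.
rewrite big1 ?addr0 // => j; rewrite -val_eqE /= => /negPf->.
by rewrite mul0r.
Qed.

Lemma ideal_span_min s J : ideal_closed J -> 0 \in J -> {subset s <= J} ->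
  {subset ideal_span s <= J}.
Proof.
move=> idJ J0 sJ _ /ideal_spanP[c ->].
apply: (big_ind (fun x => x \in J)) => // [x y|i _]; first exact: ideal_closedD.
by apply: ideal_closedM => //; apply: sJ; apply: mem_nth.
Qed.

Lemma ideal_span_sub s t : {subset s <= t} -> {subset ideal_span s <= ideal_span t}.
Proof.
move=> st; apply: ideal_span_min (ideal_span0 t) _; first exact: ideal_span_closed.
by move=> x /st; apply: mem_ideal_span.
Qed.

Lemma eq_ideal_span s t : s =i t -> ideal_span s =i ideal_span t.
Proof. by move=> st a; apply/idP/idP; apply: ideal_span_sub => x; rewrite st. Qed.

Lemma regular_flag_nat (J : nat -> {pred A}) s :
  (forall i, (i < size s)%N -> [/\ regular_mod (J i) s`_i,
     {subset J i <= J i.+1}, s`_i \in J i.+1 & ideal_closed (J i.+1)]) ->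
  regular_flag (J 0%N) s (J (size s)).
Proof.
elim: s J => [|x s IH] J Jp; first exact: regular_flag_nil.
have [reg sub xJ idJ] := Jp 0%N isT.
apply: (regular_flag_cons reg sub xJ idJ); apply: (IH (J \o S)) => i lti.
exact: (Jp i.+1).
Qed.

Lemma span_flag s :
  (forall i, (i < size s)%N -> regular_mod (ideal_span (take i s)) s`_i) ->
  regular_flag (ideal_span [::]) s (ideal_span s).
Proof.
move=> reg; rewrite -[in X in regular_flag _ _ (ideal_span X)](take_size s) -{1}(take0 s).
apply: (@regular_flag_nat (fun i => ideal_span (take i s))) => i lti.
split; first exact: reg; last exact: ideal_span_closed.
  by apply: ideal_span_sub => x xs; rewrite (take_nth 0 lti) mem_rcons inE xs orbT.
by apply: mem_ideal_span; rewrite (take_nth 0 lti) mem_rcons inE eqxx.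
Qed.

Lemma prime_regular (P : prime_idealr A) x : x \notin P -> regular_mod P x.
Proof. by move=> xP a; rewrite prime_idealrM (negPf xP). Qed.

(** An element of [p i.+1] outside [p i] is regular modulo [p i] because [p i] is prime. *)
Lemma chain_flag (p : nat -> prime_idealr A) n : prime_chain p n ->
  exists2 s, size s = n & regular_flag (p 0%N) s (p n).
Proof.
move=> ch; have ex i : exists x, (i < n)%N -> x \in p i.+1 /\ x \notin p i.
  have [lti|_] := ltnP i n; last by exists 0.
  apply: contrapT => nox; have [_] := ch i lti; apply => x xp.
  by apply: contrapT => /negP xp'; apply: nox; exists x.
have [x xP] := choice ex; exists (mkseq x n); first exact: size_mkseq.
rewrite -{2}(size_mkseq x n).
apply: (@regular_flag_nat (fun i => p i)) => i; rewrite size_mkseq => lti.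
have [xp xp'] := xP i lti; rewrite nth_mkseq //.
by split=> //; [exact: prime_regular | exact: (ch i lti).1
               | exact: idealr_ideal_closed].
Qed.

End Spans.

Section KernelPrime.
Variables (A B : comNzRingType) (f : {rmorphism A -> B}).
Hypothesis B_domain : forall x y : B, x * y = 0 -> (x == 0) || (y == 0).

Definition kernel_pred : {pred A} := fun a => f a == 0.

Lemma kernel_idealr_closed : idealr_closed kernel_pred.
Proof.
rewrite /kernel_pred; split; rewrite ?inE.
- by rewrite unfold_in rmorph0.
- by rewrite unfold_in rmorph1 oner_eq0.
- move=> a u v; rewrite !unfold_in rmorphD rmorphM => /eqP-> /eqP->.
  by rewrite mulr0 addr0.
Qed.

Lemma kernel_prime_closed : prime_idealr_closed kernel_pred.
Proof. by move=> a b; rewrite !unfold_in rmorphM => /eqP/B_domain. Qed.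
End KernelPrime.

Section MakeIdeals.
Variable A : comNzRingType.

Section Idealr.
Variables (J : {pred A}) (idJ : idealr_closed J).
(** The proof is kept as an argument so that the ideal structure can be attached to this term. *)
Definition idealr_pred (_ : idealr_closed J) : {pred A} := J.
HB.instance Definition _ := isIdealr.Build A (idealr_pred idJ) idJ.
Definition to_idealr : idealr A := idealr_pred idJ.
End Idealr.

Section Prime.
Variables (J : {pred A}) (idJ : idealr_closed J) (prJ : prime_idealr_closed J).
Definition prime_pred (_ : idealr_closed J) (_ : prime_idealr_closed J) :
  {pred A} := J.
HB.instance Definition _ := isIdealr.Build A (prime_pred idJ prJ) idJ.
HB.instance Definition _ := isPrimeIdealrClosed.Build A (prime_pred idJ prJ) prJ.
Definition to_prime : prime_idealr A := prime_pred idJ prJ.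
End Prime.
End MakeIdeals.

(** * Monomial ideals and primes generated by variables *)

Section MonomialIdeals.
Variables (K : fieldType) (d : nat).
Implicit Types (a b : {mpoly K[d]}) (m : 'X_{1..d}) (S D : {set 'I_d}).

Section UpClosed.
Variable Q : pred 'X_{1..d}.
Hypothesis Qup : forall m m', Q m -> Q (m + m')%MM.

Definition mono_ideal : {pred {mpoly K[d]}} := fun a => all Q (msupp a).

Lemma mono_idealP a : reflect {in msupp a, forall m, Q m} (a \in mono_ideal).
Proof. exact: allP. Qed.

Lemma mono_ideal_closed : ideal_closed mono_ideal.
Proof.
move=> a u v /mono_idealP uQ /mono_idealP vQ; apply/mono_idealP => m.
move/msuppD_le; rewrite mem_cat => /orP[|/vQ//].
by move/msuppM_le => /allpairsP[[m1 m2] /= [_ /uQ Qm2 ->]]; rewrite addmC; apply: Qup.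
Qed.

Lemma mono_ideal0 : 0 \in mono_ideal.
Proof. by apply/mono_idealP => m; rewrite msupp0. Qed.

End UpClosed.

(** For a monomial, [meets] is membership in the ideal of the variables in [S], and [contains] is
    divisibility by their product. *)
Definition meets S : pred 'X_{1..d} := fun m => [exists j in S, m j != 0%N].
Definition contains S : pred 'X_{1..d} := fun m => [forall j in S, m j != 0%N].

Lemma meets_up S m m' : meets S m -> meets S (m + m')%MM.
Proof.
move=> /exists_inP[j jS mj]; apply/exists_inP; exists j => //.
by rewrite mnmDE addn_eq0 negb_and mj.
Qed.

Lemma contains_up S m m' : contains S m -> contains S (m + m')%MM.
Proof.
move=> /forall_inP mS; apply/forall_inP => j jS.
by rewrite mnmDE addn_eq0 negb_and mS.
Qed.

(** Setting the variables in [S] to 0 is an endomorphism of a domain whose kernel is the ideal they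
    generate; hence that ideal is prime. *)
Definition kill S : {mpoly K[d]} -> {mpoly K[d]} :=
  mmap (@mpolyC d K) (fun j => if j \in S then 0 else 'X_j).

HB.instance Definition _ S := GRing.RMorphism.copy (kill S)
  (mmap (@mpolyC d K) (fun j => if j \in S then 0 else 'X_j)).

Lemma killX S m : kill S 'X_[m] = if meets S m then 0 else 'X_[m].
Proof.
rewrite /kill mmapX /mmap1; case: ifPn => [/exists_inP[j jS mj]|mS].
  by rewrite (bigD1 j) //= jS expr0n (negPf mj) mul0r.
rewrite [RHS]mpolyXE_id; apply: eq_bigr => j _; case: ifP => // jS.
suff -> : m j = 0%N by rewrite !expr0.
by apply/eqP; apply: contraR mS => mj; apply/exists_inP; exists j.
Qed.

Lemma mcoeff_kill S a m : (kill S a)@_m = if meets S m then 0 else a@_m.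
Proof.
rewrite {1}[a]mpolyE (rmorph_sum (kill S)) /= (raddf_sum (mcoeff m)) /=.
have killZ c b : kill S (c *: b) = c *: kill S b by rewrite /kill mmapZ mul_mpolyC.
under eq_bigr do rewrite killZ killX mcoeffZ.
case: ifPn => mS.
  rewrite big1 // => m' _; case: ifPn => m'S; first by rewrite mcoeff0 mulr0.
  by rewrite mcoeffX; case: eqP m'S => [->|]; rewrite ?mS ?mulr0.
rewrite [in RHS](mpolyE a) raddf_sum; apply: eq_bigr => m' _ /=.
rewrite mcoeffZ; case: ifPn => // m'S; rewrite mcoeff0 mcoeffX.
by case: eqP m'S mS => [->->|].
Qed.

Lemma kill_eq0 S a : (kill S a == 0) = (a \in mono_ideal (meets S)).
Proof.
apply/eqP/mono_idealP => [a0 m|aS].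
  rewrite mcoeff_msupp; apply: contraNT => mS.
  by have := mcoeff_kill S a m; rewrite a0 mcoeff0 (negPf mS) => <-.
apply/mpolyP => m; rewrite mcoeff_kill mcoeff0; case: ifPn => // mS.
by apply/eqP; rewrite mcoeff_eq0; apply: contra mS => /aS.
Qed.

Lemma coord_ideal_closed S : idealr_closed (mono_ideal (meets S)).
Proof.
split; first exact: mono_ideal0.
  by rewrite -kill_eq0 rmorph1 oner_eq0.
exact/mono_ideal_closed/meets_up.
Qed.

Lemma coord_prime_closed S : prime_idealr_closed (mono_ideal (meets S)).
Proof. by move=> a b; rewrite -!kill_eq0 rmorphM mulf_eq0. Qed.

Definition coord_prime S : prime_idealr {mpoly K[d]} :=
  to_prime (coord_ideal_closed S) (@coord_prime_closed S).

Lemma coord_primeE S a : (a \in coord_prime S) = (kill S a == 0).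
Proof. by rewrite kill_eq0. Qed.

Lemma mem_coord_prime S j : ('X_j \in coord_prime S) = (j \in S).
Proof.
rewrite coord_primeE killX; case: ifPn => [|mS]; rewrite ?eqxx.
  by case/exists_inP=> i iS; rewrite mnm1E; case: (j =P i) => // ->; rewrite iS.
rewrite -msupp_eq0 msuppX; apply/esym/negP => jS; case/negP: mS.
by apply/exists_inP; exists j; rewrite // mnm1E eqxx.
Qed.

Lemma coord_prime_sub S D : S \subset D -> {subset coord_prime S <= coord_prime D}.
Proof.
move=> /subsetP SD a /mono_idealP aS; apply/mono_idealP => m /aS.
by case/exists_inP=> j /SD jD mj; apply/exists_inP; exists j.
Qed.

Lemma coord_flag S (l : seq 'I_d) : uniq l -> {in l, forall j, j \notin S} ->
  regular_flag (coord_prime S) [seq 'X_j | j <- l] (coord_prime (S :|: [set j in l])).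
Proof.
elim: l S => [|j l IH] S /=.
  move=> _ _; have -> : S :|: [set j in [::]] = S by apply/setP => j; rewrite !inE orbF.
  exact: regular_flag_nil.
move=> /andP[jl ul] lS.
have -> : S :|: [set i in j :: l] = (j |: S) :|: [set i in l].
  by apply/setP => i; rewrite !inE orbCA orbA.
have jS : j \notin S by apply: lS; rewrite inE eqxx.
apply: (@regular_flag_cons _ _ _ (coord_prime (j |: S))).
- by apply: prime_regular; rewrite mem_coord_prime.
- by apply: coord_prime_sub; exact: subsetU1.
- by rewrite mem_coord_prime !inE eqxx.
- exact: idealr_ideal_closed.
apply: IH => // i il; rewrite !inE negb_or lS ?inE ?il ?orbT // andbT.
by apply: contraNneq jl => <-.
Qed.

Definition mono S : {mpoly K[d]} := \prod_(j in S) 'X_j.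

Lemma mesym1_val S j : mesym1 S j = (j \in S) :> nat.
Proof. exact: mnmE. Qed.

Lemma monoE S : mono S = 'X_[mesym1 S].
Proof.
rewrite /mono mpolyXE_id big_mkcond; apply: eq_bigr => j _ /=.
by rewrite mesym1_val; case: (j \in S); rewrite ?expr1 ?expr0.
Qed.

Lemma contains_mesym1 S m : contains S m = (mesym1 S <= m)%MM.
Proof.
apply/forall_inP/mnm_lepP => Sm j; have := Sm j; rewrite mesym1_val.
  by case: (j \in S) => // /(_ isT); rewrite lt0n.
by move=> + jS; rewrite jS lt0n.
Qed.

Lemma meets_mesym1 S D : meets S (mesym1 D) = (S :&: D != set0).
Proof.
apply/exists_inP/set0Pn => [[j jS]|[j /setIP[jS jD]]]; last first.
  by exists j; rewrite // mesym1_val jD.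
by rewrite mesym1_val; case: (boolP (j \in D)) => // jD _; exists j; rewrite inE jS.
Qed.

Lemma mono_coord_prime S D : (mono D \in coord_prime S) = (S :&: D != set0).
Proof.
rewrite -meets_mesym1 monoE; apply/mono_idealP/idP => [|SD m].
  by apply; rewrite msuppX inE.
by rewrite msuppX inE => /eqP->.
Qed.

Lemma ideal_span_mono (F : seq {set 'I_d}) a :
  (a \in ideal_span [seq mono C | C <- F])
    = (a \in mono_ideal (fun m => has (contains^~ m) F)).
Proof.
apply/idP/idP => [|/mono_idealP aF].
  move: a; apply: ideal_span_min; last 2 first.
  - exact: mono_ideal0.
  - move=> _ /mapP[C CF ->]; apply/mono_idealP => m; rewrite monoE msuppX inE.
    move=> /eqP->; apply/hasP; exists C => //.
    by rewrite contains_mesym1 lepm_refl.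
  apply: mono_ideal_closed => m m' /hasP[C CF Cm]; apply/hasP; exists C => //.
  exact: contains_up.
rewrite [a]mpolyE; rewrite big_seq.
apply: (big_ind (fun x => x \in ideal_span _)) => [|x y|m /aF/hasP[C CF Cm]].
- exact: ideal_span0.
- exact/ideal_closedD/ideal_span_closed.
rewrite contains_mesym1 in Cm; rewrite -(submK Cm) mpolyXD -monoE scalerAl.
apply: ideal_closedM; first exact: ideal_span_closed.
by apply: mem_ideal_span; apply: map_f.
Qed.

End MonomialIdeals.

(** * Unmixedness and complete intersections *)

Lemma set_chain (d : nat) (D E : {set 'I_d}) : D \subset E ->
  exists F : nat -> {set 'I_d}, [/\ F 0%N = D, F #|E :\: D| = E &
    forall i, (i < #|E :\: D|)%N -> exists2 j, j \notin F i & F i.+1 = j |: F i].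
Proof.
move=> DE; pose l := enum (E :\: D).
exists (fun i => D :|: [set j in take i l]); split.
- by apply/setP => j; rewrite take0 !inE orbF.
- apply/setP => j; rewrite take_oversize -?cardE // !inE mem_enum inE.
  by case: (boolP (j \in D)) => // /(subsetP DE).
move=> i; rewrite cardE -/l => lti.
have j0 : 'I_d by case: l lti => [|x _ _] //; exact: x.
have nthD : nth j0 l i \notin D.
  by have := mem_nth j0 lti; rewrite mem_enum inE => /andP[].
exists (nth j0 l i).
  rewrite !inE negb_or nthD /=.
  have := enum_uniq (E :\: D); rewrite -/l -{1}(cat_take_drop i l) cat_uniq.
  case/and3P => _ /hasPn dis _; apply: dis.
  by rewrite (drop_nth j0 lti) inE eqxx.
by apply/setP => k; rewrite (take_nth j0 lti) !inE mem_rcons inE orbCA.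
Qed.

(** * Bounds on flags, and heights *)

Section Bounds.
Variables (K : fieldType) (d : nat).
Implicit Types (D : {set 'I_d}) (J : {pred {mpoly K[d]}}).

(** With more than [d] elements, [s ++ t] would satisfy a relation with value 0, which lies in [J];
    following it along both flags puts 1 into [J3]. *)
Lemma flag_bound J J1 J2 J3 s t :
  regular_flag J s J1 -> {subset J1 <= J2} -> regular_flag J2 t J3 ->
  0 \in J -> 1 \notin J3 -> (size s + size t <= d)%N.
Proof.
move=> fl1 sub fl2 J0 J31; rewrite leqNgt -size_cat; apply/negP.
move/long_seq_collapses => /(collapses_flag fl1)/(_ J0)[v /sub vJ2].
rewrite -[t]cats0 => /(collapses_flag fl2)/(_ vJ2)[w wJ3 /= w1].
by rewrite w1 (negPf J31) in wJ3.
Qed.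

Lemma coord_prime_min D J : ideal_closed J -> 0 \in J ->
  {in D, forall j, 'X_j \in J} -> {subset coord_prime K D <= J}.
Proof.
move=> idJ J0 DJ a /mono_idealP aD; rewrite [a]mpolyE big_seq.
apply: (big_ind (fun x => x \in J)) => // [x y|m /aD/exists_inP[j jD mj]].
  exact: ideal_closedD.
have jm : (U_(j) <= m)%MM by rewrite lep1mP.
by rewrite -(submK jm) mpolyXD scalerAl ideal_closedM // DJ.
Qed.

Lemma coord_flagC D :
  regular_flag (coord_prime K D) [seq 'X_j | j <- enum (~: D)] (coord_prime K setT).
Proof.
have -> : [set: 'I_d] = D :|: [set j in enum (~: D)].
  by apply/setP => j; rewrite !inE mem_enum inE orbN.
by apply: coord_flag => [|j]; rewrite ?enum_uniq // mem_enum inE.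
Qed.

(** Adding the variables one at a time gives a chain of length [#|D|]. Any chain up to this prime
    continues by the [d - #|D|] other variables, so the bound [d] on flags limits its length. *)
Lemma height_coord_prime D : height (coord_prime K D) #|D|.
Proof.
split.
  have [F [F0 FD FS]] := set_chain (sub0set D); rewrite setD0 in FD FS.
  exists (fun i => coord_prime K (F i)) => [i /FS[j jF ->]|a]; last by rewrite FD.
  split; first exact/coord_prime_sub/subsetU1.
  by move=> /(_ 'X_j); rewrite !mem_coord_prime !inE eqxx (negPf jF) => /(_ isT).
move=> n [q qch qD]; have qD' : {subset q n <= coord_prime K D} by move=> a; rewrite qD.
have [s sn fl] := chain_flag qch; rewrite -sn.
have := flag_bound fl qD' (coord_flagC D) (idealr0 _).
rewrite idealr1 size_map -cardE (cardsCs (~: D)) setCK card_ord => /(_ isT).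
have leDd : (#|D| <= d)%N by rewrite -[X in (_ <= X)%N]card_ord max_card.
by rewrite addnBA // leq_subLR leq_add2r.
Qed.

Lemma eq_height (A : comNzRingType) (P Q : prime_idealr A) n :
  P =i Q -> height P n <-> height Q n.
Proof.
move=> PQ; split=> -[[p pch pP] pmax]; split.
- by exists p => // a; rewrite pP PQ.
- by move=> m [q qch qQ]; apply: pmax; exists q => // a; rewrite qQ PQ.
- by exists p => // a; rewrite pP PQ.
- by move=> m [q qch qQ]; apply: pmax; exists q => // a; rewrite qQ PQ.
Qed.

Lemma is_maximum_uniq S m n : is_maximum S m -> is_maximum S n -> m = n.
Proof.
by move=> [Sm mmax] [Sn nmax]; apply/eqP; rewrite eqn_leq mmax ?nmax.
Qed.

(** A squarefree monomial in variables outside [C] that divides [mono C] times a monomial already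
    divides that monomial. *)
Lemma disjoint_mono_regular (F : seq {set 'I_d}) (C : {set 'I_d}) :
  {in F, forall B : {set 'I_d}, [disjoint B & C]} ->
  regular_mod (ideal_span [seq mono K B | B <- F]) (mono K C).
Proof.
move=> FC a; rewrite !ideal_span_mono => /mono_idealP Ca.
apply/mono_idealP => m ma.
have /Ca/hasP[B BF Bm] : (mesym1 C + m)%MM \in msupp (mono K C * a).
  by rewrite mcoeff_msupp monoE mulrC mcoeffMX -mcoeff_msupp.
apply/hasP; exists B => //; apply/forall_inP => j jB.
have := forall_inP Bm j jB; rewrite mnmDE mesym1_val.
by rewrite (disjointFr (FC B BF) jB).
Qed.

End Bounds.

Lemma pi_eq0 (R : comNzRingType) (J : idealr R) (x : R) :
  (\pi_({ideal_quot J}) x == 0) = (x \in J).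
Proof. by rewrite -[x in RHS]subr0 Quotient.idealrBE rmorph0. Qed.

Lemma associated_primeP (R : comNzRingType) (J : idealr R) (P : prime_idealr R) :
  associated_prime J P <-> exists y, forall a, (a \in P) = (a * y \in J).
Proof.
split=> [[x xP]|[y yP]].
  exists (repr x) => a; rewrite xP -{1}[x]reprK.
  by rewrite -(rmorphM (\pi_({ideal_quot J}))) pi_eq0.
by exists (\pi_({ideal_quot J}) y) => a; rewrite yP -rmorphM pi_eq0.
Qed.

(** * Associated primes and generators of the closed neighborhood ideal *)

Section ClosedNbhdIdeal.
Variables (K : fieldType) (d : nat) (T : rel 'I_d).
Local Notation N := (closed_nbhd T).
Local Notation I := (closed_nbhd_ideal K T).
Implicit Types (D : {set 'I_d}) (a : {mpoly K[d]}).

Lemma closed_nbhd_idealP a :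
  reflect {in msupp a, forall m, exists i, contains (N i) m} (a \in I).
Proof.
have IE b : (b \in I) = (b \in ideal_span [seq closed_nbhd_monomial K T i | i <- enum 'I_d]) by [].
rewrite IE.
have -> : [seq closed_nbhd_monomial K T i | i <- enum 'I_d]
    = [seq mono K C | C <- [seq N i | i <- enum 'I_d]].
  by rewrite -[RHS]map_comp.
rewrite ideal_span_mono; apply: (iffP (mono_idealP _ _)) => aI m /aI.
  by move=> /hasP[_ /mapP[i _ ->] im]; exists i.
by move=> [i im]; apply/hasP; exists (N i) => //; apply: map_f; rewrite mem_enum.
Qed.

Lemma mono_closed_nbhd_ideal i : mono K (N i) \in I.
Proof. by apply: mem_ideal_span; apply: map_f; rewrite mem_enum. Qed.

Lemma closed_nbhd_ideal_sub D : dominating T D -> {subset I <= coord_prime K D}.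
Proof.
move=> /forallP Ddom a /closed_nbhd_idealP aI; apply/mono_idealP => m /aI[i im].
have /set0Pn[j /setIP[jD ji]] := Ddom i; apply/exists_inP; exists j => //.
exact: (forall_inP im).
Qed.

(** The ideal is the intersection of the primes of the minimal dominating sets: if no generator
    divides a monomial of [a], the variables absent from this monomial form a dominating set. *)
Lemma closed_nbhd_ideal_radical a : a \notin I ->
  exists2 D, minset (dominating T) D & a \notin coord_prime K D.
Proof.
move=> aI; have [m ma mI] : exists2 m, m \in msupp a & forall i, ~~ contains (N i) m.
  apply: contrapT => nom; case/negP: aI; apply/closed_nbhd_idealP => m ma.
  apply: contrapT => noi; apply: nom; exists m => // i.
  by apply/negP => im; apply: noi; exists i.
have domZ : dominating T [set j | m j == 0%N].
  apply/forallP => i; have /forall_inPn[j ji] := mI i; rewrite negbK => mj.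
  by apply/set0Pn; exists j; rewrite inE ji inE mj.
have [D Dmin DZ] := minset_exists domZ; exists D => //.
apply/negP => /mono_idealP/(_ m ma)/exists_inP[j /(subsetP DZ)].
by rewrite inE => ->.
Qed.

Lemma prime_over_closed_nbhd_ideal (P : prime_idealr {mpoly K[d]}) :
  {subset I <= P} ->
  exists2 D, minset (dominating T) D & {subset coord_prime K D <= P}.
Proof.
move=> IP; have prodP (S : {set 'I_d}) : mono K S \in P -> exists2 j, j \in S & 'X_j \in P.
  rewrite /mono; elim/big_rec: _ => [|j a jS IH]; first by rewrite idealr1.
  by rewrite prime_idealrM => /orP[|/IH//]; exists j.
have domP : dominating T [set j | 'X_j \in P].
  apply/forallP => i; have [j ji jP] := prodP _ (IP _ (mono_closed_nbhd_ideal i)).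
  by apply/set0Pn; exists j; rewrite inE ji inE jP.
have [D Dmin DP] := minset_exists domP; exists D => //.
apply: coord_prime_min => [||j /(subsetP DP)]; last by rewrite inE.
  exact: idealr_ideal_closed.
exact: idealr0.
Qed.

Lemma minset_private D j : minset (dominating T) D -> j \in D ->
  exists i, D :&: N i = [set j].
Proof.
move=> /minsetP[Ddom Dmin] jD.
have [domD|] := boolP (dominating T (D :\ j)).
  by have := Dmin _ domD (subD1set D j); move=> /setP/(_ j); rewrite !inE jD eqxx.
move=> /forallPn[i]; rewrite negbK => /eqP Di0; exists i.
have /set0Pn[k kDi] := forallP Ddom i.
have eqj k' : k' \in D :&: N i -> k' = j.
  move=> /setIP[kD ki]; apply/eqP; apply: contraT => kj.
  by move/setP: Di0 => /(_ k'); rewrite !inE kj kD /=; move: ki; rewrite inE => ->.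
apply/setP => k'; rewrite in_set1; apply/idP/eqP => [/eqj//|->].
by rewrite -(eqj k kDi).
Qed.

(** The prime of [D] is the annihilator of the product of the variables outside [D]. Indeed each [j]
    in [D] has some [i] whose closed neighborhood meets [D] only in [j], so that ['X_j] times this
    product is a multiple of the generator of [i]. *)
Lemma mono_compl_annihilator D a : minset (dominating T) D ->
  (a * mono K (~: D) \in I) = (a \in coord_prime K D).
Proof.
move=> Dmin; apply/idP/idP => [|/mono_idealP aD].
  have /minsetP[Ddom _] := Dmin; move/(closed_nbhd_ideal_sub Ddom).
  by rewrite prime_idealrM mono_coord_prime setICr eqxx orbF.
apply/closed_nbhd_idealP => m.
rewrite monoE (perm_mem (msuppMX _ _)) => /mapP[m' /aD/exists_inP[j jD mj] ->].
have [i iD] := minset_private Dmin jD; exists i; apply/forall_inP => k ki.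
rewrite mnmDE mesym1_val inE addn_eq0 negb_and.
have [kD|//] := boolP (k \in D).
have : k \in D :&: N i by rewrite inE kD.
by rewrite iD inE => /eqP->; rewrite mj.
Qed.

(** If [P] annihilates [y], then [y] avoids the prime of some minimal [D], which therefore contains
    [P]. But [P] contains the prime of some minimal [E], and minimality of [D] forces [E = D]. *)
Lemma associated_closed_nbhdP (P : prime_idealr {mpoly K[d]}) :
  associated_prime (closed_nbhd_ideal K T) P <->
  exists2 D, minset (dominating T) D & P =i coord_prime K D.
Proof.
split=> [/associated_primeP[y yP]|[D Dmin PD]]; last first.
  apply/associated_primeP; exists (mono K (~: D)) => a.
  by rewrite mono_compl_annihilator.
have yI : y \notin I by rewrite -[y]mul1r -yP idealr1.
have [D Dmin yD] := closed_nbhd_ideal_radical yI.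
have IP : {subset I <= P} by move=> a aI; rewrite yP mulrC idealMr.
have [E Emin EP] := prime_over_closed_nbhd_ideal IP.
have PD : {subset P <= coord_prime K D}.
  move=> a; rewrite yP => /closed_nbhd_ideal_sub; have /minsetP[Ddom _] := Dmin.
  by move=> /(_ _ Ddom); rewrite prime_idealrM (negPf yD) orbF.
have ED : E = D.
  have /minsetP[_ minD] := Dmin; have /minsetP[Edom _] := Emin.
  apply: minD => //; apply/subsetP => j jE.
  by have := PD 'X_j (EP _ _); rewrite !mem_coord_prime; apply.
by exists D => // a; apply/idP/idP => [/PD//|]; rewrite -ED => /EP.
Qed.

Lemma unmixed_domination : unmixed (closed_nbhd_ideal K T) <-> domination_unmixed T.
Proof.
split=> [unm D E Dmin Emin|unm P Q].
  have ass B : minset (dominating T) B ->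
      associated_prime (closed_nbhd_ideal K T) (coord_prime K B).
    by move=> Bmin; apply/associated_closed_nbhdP; exists B.
  have /(unm _ _ (ass D Dmin) (ass E Emin)) := height_coord_prime K D.
  by move/is_maximum_uniq; apply; apply: height_coord_prime.
move=> /associated_closed_nbhdP[D Dmin PD] /associated_closed_nbhdP[E Emin QE] h.
have hD := height_coord_prime K D; have hE := height_coord_prime K E.
rewrite (eq_height _ PD) (eq_height _ QE).
split=> [/is_maximum_uniq/(_ hD)->|/is_maximum_uniq/(_ hE)->].
  by rewrite (unm D E).
by rewrite -(unm D E).
Qed.

Lemma star_packing_span L p : star_packing T L p ->
  I =i ideal_span [seq mono K (N l) | l <- enum L].
Proof.
move=> [_ _ cov] a.
have -> : [seq mono K (N l) | l <- enum L]
    = [seq mono K C | C <- [seq N l | l <- enum L]] by rewrite -[RHS]map_comp.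
rewrite ideal_span_mono.
apply/closed_nbhd_idealP/mono_idealP => aI m /aI.
  move=> [i /forall_inP im]; have [l lL [_ /subsetP li]] := cov i.
  apply/hasP; exists (N l); first by apply: map_f; rewrite mem_enum.
  by apply/forall_inP => j /li/im.
by move=> /hasP[_ /mapP[l _ ->] lm]; exists l.
Qed.

Lemma star_packing_regular L p : star_packing T L p ->
  regular_sequence [seq mono K (N l) | l <- enum L].
Proof.
move=> Lp; have [_ disj _] := Lp; split; last first.
  by rewrite -(star_packing_span Lp) idealr1.
move=> i; rewrite size_map => lti a.
have l0 : 'I_d by case: (enum L) lti => [|x _ _] //; exact: x.
set l := nth l0 (enum L) i; have lL : l \in L by rewrite -mem_enum mem_nth.
rewrite (nth_map l0) // -map_take -/l.
have -> : [seq mono K (N l) | l <- take i (enum L)]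
    = [seq mono K C | C <- [seq N l | l <- take i (enum L)]] by rewrite -[RHS]map_comp.
apply: disjoint_mono_regular => _ /mapP[m mi ->]; apply: disj => //.
  by rewrite -mem_enum; apply: mem_take mi.
have := enum_uniq L; rewrite -{1}(cat_take_drop i (enum L)) cat_uniq.
case/and3P => _ /hasPn dis _; apply: contraTneq mi => ->; apply: dis.
by rewrite (drop_nth l0 lti) inE eqxx.
Qed.

Lemma coord_prime_meval D a :
  a \in coord_prime K D -> a.@[fun j => (j \notin D)%:R] = 0.
Proof.
move=> /mono_idealP aD; rewrite mevalE big_seq big1 // => m /aD/exists_inP[j jD mj].
by rewrite (bigD1 j) //= jD expr0n (negPf mj) mul0r mulr0.
Qed.

(* Up to a unit at the point [v], which is 0 on [D] and 1 elsewhere, the ideal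
   is generated by the variables in [D]; so the Jacobian matrix of any system of
   generators has rank at least [#|D|] at [v]. *)
Lemma minset_card_le D s : minset (dominating T) D ->
  I =i ideal_span s -> (#|D| <= size s)%N.
Proof.
move=> Dmin Is; have /minsetP[Ddom _] := Dmin.
pose v (j : 'I_d) : K := (j \notin D)%:R; pose y := mono K (~: D).
have /fin_all_exists[c cP] (j : 'I_d) : exists c : nat -> {mpoly K[d]},
    j \in D -> 'X_j * y = \sum_(k < size s) c k * s`_k.
  have [jD|_] := boolP (j \in D); last by exists (fun=> 0).
  have : 'X_j * y \in I by rewrite mono_compl_annihilator // mem_coord_prime.
  by rewrite Is => /ideal_spanP[c ->]; exists c.
(* As the generators vanish at [v], the product rule makes the product of [C] and [B] the matrix of
   derivatives of the ['X_j * y] at [v], which is the identity. *)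
pose C := \matrix_(i < #|D|, k < size s) (c (enum_val i) k).@[v].
pose B := \matrix_(k < size s, i < #|D|) (s`_k^`M(enum_val i)).@[v].
apply: (@mulmx1_min K _ _ C B); apply/matrixP => i i'; rewrite !mxE.
have iD := enum_valP i; have i'D := enum_valP i'.
have := congr1 (fun f => (f^`M(enum_val i')).@[v]) (cP _ iD).
have vi : v (enum_val i) = 0 by rewrite /v iD.
have yv : y.@[v] = 1.
  rewrite /y /mono rmorph_prod big1 //= => j; rewrite inE => jD.
  by rewrite mevalXU /v jD.
have -> : ('X_(enum_val i) * y)^`M(enum_val i').@[v] = (i == i')%:R.
  rewrite mderivM mevalD !mevalM mevalXU vi mul0r addr0 yv mulr1.
  rewrite mderivX mevalZ mnm1E (inj_eq enum_val_inj).
  case: eqP => [->|_]; last by rewrite mul0r.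
  have -> : (U_(enum_val i') - U_(enum_val i'))%MM = 0%MM.
    by apply/mnmP => j; rewrite mnmBE subnn mnm0E.
  by rewrite mpolyX0 meval1 mulr1.
move=> ->; rewrite (raddf_sum (mderiv (enum_val i'))) (raddf_sum (meval v)) /=; apply: eq_bigr => k _.
rewrite !mxE mderivM mevalD !mevalM.
have -> : (s`_k).@[v] = 0.
  apply/coord_prime_meval/(closed_nbhd_ideal_sub Ddom).
  by rewrite Is; apply/mem_ideal_span/mem_nth.
by rewrite mulr0 add0r.
Qed.

Lemma complete_intersection_domination :
  complete_intersection (closed_nbhd_ideal K T) -> domination_unmixed T.
Proof.
case=> s [sreg s1] Is.
suff card D : minset (dominating T) D -> #|D| = size s.
  by move=> D E /card-> /card->.
move=> Dmin; have /minsetP[Ddom _] := Dmin.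
have sD : {subset ideal_span s <= coord_prime K D}.
  by move=> a; rewrite -Is; apply: closed_nbhd_ideal_sub.
apply/eqP; rewrite eqn_leq (minset_card_le Dmin Is) /=.
have := flag_bound (span_flag sreg) sD (coord_flagC K D) (ideal_span0 _).
rewrite idealr1 size_map -cardE (cardsCs (~: D)) setCK card_ord => /(_ isT).
have leDd : (#|D| <= d)%N by rewrite -[X in (_ <= X)%N]card_ord max_card.
by rewrite addnBA // leq_subLR leq_add2r.
Qed.

End ClosedNbhdIdeal.

(** * Localizations of quotients *)

Section Comap.
Variables (A B : comNzRingType) (f : {rmorphism A -> B}).

Definition comap_pred (P : {pred B}) : {pred A} := fun a => f a \in P.

Lemma mem_comap_pred P a : (a \in comap_pred P) = (f a \in P).
Proof. by []. Qed.

Variable P : prime_idealr B.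

Lemma comap_closed : idealr_closed (comap_pred P).
Proof.
split; rewrite ?mem_comap_pred ?rmorph0 ?idealr0 ?rmorph1 ?idealr1 //.
move=> a u v; rewrite !mem_comap_pred rmorphD rmorphM => uP vP.
exact: idealr_ideal_closed.
Qed.

Lemma comap_prime_closed : prime_idealr_closed (comap_pred P).
Proof. by move=> u v; rewrite !mem_comap_pred rmorphM prime_idealrM. Qed.

Definition comap : prime_idealr A := to_prime comap_closed comap_prime_closed.

Lemma mem_comap a : (a \in comap) = (f a \in P).
Proof. by []. Qed.

End Comap.

Section LocalizationMap.
Variables (A : comNzRingType) (P : prime_idealr A).

Definition to_loc (a : A) : localization P :=
  \pi_(localization P) (@LFrac A P (a, 1) (notin_prime1 P)).

Lemma to_loc_zmod : zmod_morphism to_loc.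
Proof.
move=> a b; change (to_loc (a - b) = loc_add (to_loc a) (loc_opp (to_loc b))).
rewrite /to_loc !piE; apply/eqP.
apply/loc_eqP; exists 1; first exact: notin_prime1.
by rewrite /=; ring.
Qed.

Lemma to_loc_monoid : monoid_morphism to_loc.
Proof.
split=> [//|a b]; change (to_loc (a * b) = loc_mul (to_loc a) (to_loc b)).
rewrite /to_loc !piE; apply/eqP.
apply/loc_eqP; exists 1; first exact: notin_prime1.
by rewrite /=; ring.
Qed.

HB.instance Definition _ := GRing.isZmodMorphism.Build _ _ to_loc to_loc_zmod.
HB.instance Definition _ := GRing.isMonoidMorphism.Build _ _ to_loc to_loc_monoid.

Lemma to_loc_eq0 a : to_loc a = 0 <-> exists2 t, t \notin P & t * a = 0.
Proof.
change (to_loc a = loc_zero P <-> exists2 t, t \notin P & t * a = 0).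
rewrite /to_loc /loc_zero.
split=> [/eqP/loc_eqP[t tP]|[t tP ta]].
  by rewrite /= !mulr1 mulr0; exists t.
by apply/eqP/loc_eqP; exists t => //=; rewrite mulr1 ta mul0r mulr0.
Qed.

Lemma to_loc_frac b : exists a t, t \notin P /\ to_loc t * b = to_loc a.
Proof.
elim/quotW: b => -[[a t] /= tP]; exists a, t; split=> //.
change (loc_mul (to_loc t) (\pi_(localization P) (@LFrac A P (a, t) tP)) = to_loc a).
rewrite /to_loc !piE; apply/eqP.
apply/loc_eqP; exists 1; first exact: notin_prime1.
by rewrite /=; ring.
Qed.

Lemma to_loc_unit t : t \notin P -> exists b, to_loc t * b = 1.
Proof.
move=> tP; exists (\pi_(localization P) (@LFrac A P (1, t) tP)); 
change (loc_mul (to_loc t) (\pi_(localization P) (@LFrac A P (1, t) tP)) = loc_one P).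
rewrite /to_loc /loc_one !piE; apply/eqP.
apply/loc_eqP; exists 1; first exact: notin_prime1.
by rewrite /=; ring.
Qed.

End LocalizationMap.

(** * Depth and dimension of a localized quotient, expressed in the ring [R] *)

Section Local.
Variables (R B : comNzRingType) (phi : {rmorphism R -> B}).
Variables (I : idealr R) (m : prime_idealr R).
Hypothesis Im : {subset I <= m}.
Hypothesis phi_eq0 : forall r, phi r = 0 <-> exists2 t, t \notin m & t * r \in I.
Hypothesis phi_frac : forall b, exists r t, t \notin m /\ phi t * b = phi r.
Hypothesis phi_unit : forall t, t \notin m -> exists b, phi t * b = 1.
Implicit Types (J : {pred R}) (s : seq R) (r t : R) (b : B).

(** The ideal of [B] generated by the image of [J]. The hypotheses on [phi] are the properties of
    the map from [R] to the localization of [R/I] at [m]. *)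
Definition extend J : {pred B} :=
  fun b => `[< exists r t, [/\ r \in J, t \notin m & phi t * b = phi r] >].

Lemma extendP J b :
  reflect (exists r t, [/\ r \in J, t \notin m & phi t * b = phi r])
          (b \in extend J).
Proof. exact: asboolP. Qed.

Lemma extend_closed J : ideal_closed J -> ideal_closed (extend J).
Proof.
move=> idJ a u v /extendP[r1 [t1 [r1J t1m e1]]] /extendP[r2 [t2 [r2J t2m e2]]].
have [r3 [t3 [t3m e3]]] := phi_frac a; apply/extendP.
exists (t2 * r3 * r1 + t1 * t3 * r2), (t1 * t2 * t3); split.
- exact: (idJ _ _ _ r1J (ideal_closedM _ idJ r2J)).
- by rewrite !notin_primeM.
rewrite !(rmorphD, rmorphM) /= -e1 -e2 -e3; ring.
Qed.

Lemma phi_extend J r : r \in J -> phi r \in extend J.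
Proof.
move=> rJ; apply/extendP; exists r, 1.
by rewrite rmorph1 mul1r idealr1.
Qed.

(* The preimage in [R] of the extension of [I + J] to the local ring [B]. *)
Definition saturation J : {pred R} :=
  fun a => `[< exists u z, [/\ u \notin m, z \in J & u * a - z \in I] >].

Lemma saturationP J a :
  reflect (exists u z, [/\ u \notin m, z \in J & u * a - z \in I])
          (a \in saturation J).
Proof. exact: asboolP. Qed.

Lemma phi_extendE J a : ideal_closed J ->
  (phi a \in extend J) = (a \in saturation J).
Proof.
move=> idJ; apply/extendP/saturationP => [[r [t [rJ tm]]]|[u [z [um zJ uz]]]].
  rewrite -rmorphM => /eqP; rewrite -subr_eq0 -rmorphB => /eqP/phi_eq0[t' t'm].
  rewrite mulrBr mulrA => e; exists (t' * t), (t' * r); split=> //.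
    by rewrite notin_primeM.
  exact: ideal_closedM.
exists z, u; split=> //; apply/eqP; rewrite -rmorphM -subr_eq0 -rmorphB; apply/eqP.
by apply/phi_eq0; exists 1; rewrite ?idealr1 ?mul1r.
Qed.

Lemma saturation_sub J : {subset J <= saturation J}.
Proof.
move=> a aJ; apply/saturationP; exists 1, a.
by rewrite idealr1 mul1r subrr idealr0.
Qed.

Lemma sub_saturation J : 0 \in J -> {subset I <= saturation J}.
Proof.
move=> J0 a aI; apply/saturationP; exists 1, 0.
by rewrite idealr1 mul1r subr0.
Qed.

Lemma saturation_prime (P : prime_idealr R) : {subset I <= P} -> {subset P <= m} ->
  saturation P =i P.
Proof.
move=> IP Pm a; apply/idP/idP; last exact: saturation_sub.
move=> /saturationP[u [z [um zP /IP]]] uz.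
have := rpredD uz zP; rewrite subrK prime_idealrM => /orP[/Pm|//].
by rewrite (negPf um).
Qed.

Lemma extend_idealr_closed (P : prime_idealr R) : {subset I <= P} -> {subset P <= m} ->
  idealr_closed (extend P).
Proof.
move=> IP Pm; split; last exact/extend_closed/idealr_ideal_closed.
  by rewrite -(rmorph0 phi); apply/phi_extend/idealr0.
rewrite -(rmorph1 phi) phi_extendE; last exact: idealr_ideal_closed.
by rewrite saturation_prime // idealr1.
Qed.

Lemma extend_prime_closed (P : prime_idealr R) : {subset I <= P} -> {subset P <= m} ->
  prime_idealr_closed (extend P).
Proof.
move=> IP Pm u v.
have [r [t [tm e]]] := phi_frac u; have [r' [t' [t'm e']]] := phi_frac v.
have extE x y b : y \notin m -> phi y * b = phi x -> (b \in extend P) = (x \in P).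
  move=> ym eb; rewrite -(saturation_prime IP Pm).
  rewrite -phi_extendE; last exact: idealr_ideal_closed.
  rewrite -eb; apply/idP/idP => [|yb].
    by apply: ideal_closedM; apply/extend_closed/idealr_ideal_closed.
  have [c yc] := phi_unit ym; rewrite -[b]mul1r -yc [phi y * c]mulrC -mulrA.
  by apply: ideal_closedM => //; apply/extend_closed/idealr_ideal_closed.
rewrite (extE (r * r') (t * t')) ?notin_primeM //; last first.
  by rewrite !rmorphM mulrACA e e'.
by rewrite (extE r t) // (extE r' t') // prime_idealrM.
Qed.

Definition extend_prime (P : prime_idealr R) (IP : {subset I <= P})
    (Pm : {subset P <= m}) : prime_idealr B :=
  to_prime (extend_idealr_closed IP Pm) (extend_prime_closed IP Pm).

Lemma mem_extend_prime P IP Pm a : (phi a \in @extend_prime P IP Pm) = (a \in P).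
Proof.
rewrite -(saturation_prime IP Pm) -phi_extendE //; exact: idealr_ideal_closed.
Qed.

Lemma proper_phi (J : idealr B) r : phi r \in J -> r \in m.
Proof.
move=> rJ; apply: contraT => /phi_unit[b rb].
by rewrite -(idealr1 J) -rb mulrC idealMr.
Qed.

Definition local_max : prime_idealr B := extend_prime Im (fun _ => id).

Lemma sub_local_max (J : idealr B) : {subset J <= local_max}.
Proof.
move=> b bJ; have [r [t [tm e]]] := phi_frac b; apply/extendP.
by exists r, t; split=> //; apply: (@proper_phi J); rewrite -e idealMr.
Qed.

Lemma maximal_idealE (J : idealr B) : maximal_ideal J -> J =i local_max.
Proof. by move=> Jmax b; rewrite -(Jmax local_max) //; apply: sub_local_max. Qed.

Lemma local_max_maximal : maximal_ideal local_max.
Proof.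
by move=> J mJ b; apply/idP/idP => [|/mJ//]; apply: sub_local_max.
Qed.

Lemma mem_local_max r : (phi r \in local_max) = (r \in m).
Proof. exact: mem_extend_prime. Qed.

(* [s] becomes a regular sequence in the local ring [B]. *)
Definition locally_regular s : Prop :=
  {subset s <= m} /\
  forall i, (i < size s)%N -> regular_mod (saturation (ideal_span (take i s))) s`_i.

Lemma ideal_span_phi s : ideal_span [seq phi r | r <- s] =i extend (ideal_span s).
Proof.
move=> b; apply/idP/idP.
  move: b; apply: ideal_span_min; first exact/extend_closed/ideal_span_closed.
    by rewrite -(rmorph0 phi); apply/phi_extend/ideal_span0.
  by move=> _ /mapP[r rs ->]; apply/phi_extend/mem_ideal_span.
move=> /extendP[r [t [rs tm e]]].
have rs' : phi r \in ideal_span [seq phi r | r <- s].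
  have [c ->] := ideal_spanP _ _ rs; rewrite rmorph_sum; apply/ideal_spanP.
  exists (fun i => phi (c i)); rewrite size_map; apply: eq_bigr => i _.
  by rewrite rmorphM (nth_map 0).
have [c tc] := phi_unit tm; rewrite -[b]mul1r -tc [phi t * c]mulrC -mulrA e.
by apply: ideal_closedM => //; apply: ideal_span_closed.
Qed.

Lemma locally_regular_phi s : locally_regular s ->
  regular_sequence [seq phi r | r <- s].
Proof.
move=> [sm sreg]; split=> [i|]; rewrite ?size_map.
  move=> lti b; rewrite (nth_map 0) // -map_take !ideal_span_phi.
  have [a [t [tm e]]] := phi_frac b; have [c tc] := phi_unit tm.
  have eqE x : (x * b \in extend (ideal_span (take i s)))
      = (x * phi a \in extend (ideal_span (take i s))).
    have cl := extend_closed (@ideal_span_closed _ (take i s)).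
    apply/idP/idP => xb.
      by rewrite -e mulrCA ideal_closedM.
    by rewrite -[b]mul1r -tc [phi t * c]mulrC -mulrA e mulrCA ideal_closedM.
  rewrite eqE -rmorphM -[b]mul1r eqE mul1r !phi_extendE; first exact: sreg.
  1,2: exact: ideal_span_closed.
rewrite ideal_span_phi -(rmorph1 phi) phi_extendE; last exact: ideal_span_closed.
apply/negP => /saturationP[u [z [um zs /Im]]]; rewrite mulr1 => uz.
have zm : z \in m.
  move: z zs {uz}; apply: ideal_span_min sm; last exact: idealr0.
  exact: idealr_ideal_closed.
by have := rpredD uz zm; rewrite subrK (negPf um).
Qed.

(** Clearing denominators multiplies each entry by a unit of [B], which changes neither the ideals
    nor regularity. *)
Lemma regular_sequence_lift (s' : seq B) : regular_sequence s' ->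
  exists2 s, size s = size s' & locally_regular s.
Proof.
move=> [reg s1].
have s'm : {subset s' <= local_max}.
  have idJ : idealr_closed (ideal_span s').
    by split=> //; [exact: ideal_span0 | exact: ideal_span_closed].
  by move=> b /mem_ideal_span bs; apply: (@sub_local_max (to_idealr idJ)).
have [f fP] := choice phi_frac.
have [g gP] := choice fP.
pose s := [seq f b | b <- s'].
have nthE i : (i < size s')%N -> s`_i = f s'`_i by move=> lti; rewrite (nth_map 0).
have ss' (t' : seq B) : {subset ideal_span [seq phi r | r <- map f t'] <= ideal_span t'}.
  apply: ideal_span_min; [exact: ideal_span_closed|exact: ideal_span0|].
  move=> _ /mapP[_ /mapP[b bt ->] ->]; have [_ <-] := gP b.
  apply: ideal_closedM; first exact: ideal_span_closed.
  exact: mem_ideal_span.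
have s's (t' : seq B) : {subset ideal_span t' <= ideal_span [seq phi r | r <- map f t']}.
  apply: ideal_span_min; [exact: ideal_span_closed|exact: ideal_span0|].
  move=> b bt; have [gm e] := gP b; have [c tc] := phi_unit gm.
  rewrite -[b]mul1r -tc [phi _ * c]mulrC -mulrA e.
  apply: ideal_closedM; first exact: ideal_span_closed.
  by apply: mem_ideal_span; do 2!apply: map_f.
exists s; first exact: size_map.
split=> [_ /mapP[b /s'm bm ->]|i].
  by rewrite -mem_local_max -(gP b).2 idealMr.
rewrite size_map => lti a.
have cl := @ideal_span_closed _ (take i s).
rewrite -!phi_extendE // -!ideal_span_phi -map_take => /ss'.
rewrite nthE // rmorphM -(gP _).2.
rewrite -mulrA => h; apply: s's; apply: (reg i lti).
have [c gc] := phi_unit (gP s'`_i).1.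
have := ideal_closedM c (@ideal_span_closed _ _) h.
by rewrite mulrA [c * _]mulrC gc mul1r.
Qed.

Lemma depth_local (M : idealr B) n : maximal_ideal M ->
  depth M n <-> is_maximum (fun k => exists2 s, size s = k & locally_regular s) n.
Proof.
move=> /maximal_idealE Mm.
have eqS k : (exists s : seq B, [/\ size s = k, {subset s <= M} & regular_sequence s]) <->
    (exists2 s, size s = k & locally_regular s).
  split=> [[s [sk _ /regular_sequence_lift[s' s's ls']]]|[s sk ls]].
    by exists s'; rewrite // s's.
  exists [seq phi r | r <- s]; split; rewrite ?size_map //.
    by move=> _ /mapP[r rs ->]; rewrite Mm mem_local_max; exact: ls.1.
  exact: locally_regular_phi.
by split=> -[/eqS nS nmax]; split=> // k /eqS/nmax.
Qed.

Definition primes_between (p : nat -> prime_idealr R) n : Prop :=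
  [/\ prime_chain p n, {subset I <= p 0%N} & {subset p n <= m}].

Lemma prime_chain_sub (A : comNzRingType) (p : nat -> prime_idealr A) n i j :
  prime_chain p n -> (i <= j <= n)%N -> {subset p i <= p j}.
Proof.
move=> pch /andP[+ jn]; elim: j jn => [|j IH] jn; first by rewrite leqn0 => /eqP->.
rewrite leq_eqVlt ltnS => /predU1P[->//|ij] a /(IH (ltnW jn) ij).
exact: (pch j jn).1.
Qed.

(** Preimage and extension match the primes of [B] with the primes of [R] between [I] and [m],
    strict inclusions included. *)
Lemma krull_dim_local n :
  krull_dim B n <-> is_maximum (fun k => exists p, primes_between p k) n.
Proof.
have eqS k : (exists p, prime_chain (A := B) p k) <-> (exists p, primes_between p k).
  split=> [[p pch]|[p [pch Ip pm]]].
    exists (fun i => comap phi (p i)); split=> [i lti|a aI|a]; last exact: proper_phi.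
      have [sub nsub] := pch i lti; split=> [a|subR]; first by rewrite !mem_comap => /sub.
      apply: nsub => b; have [r [t [tm e]]] := phi_frac b => bp.
      have : r \in comap phi (p i) by apply: subR; rewrite mem_comap -e idealMr.
      rewrite mem_comap -e prime_idealrM => /orP[/proper_phi|//].
      by rewrite (negPf tm).
    rewrite mem_comap; have -> : phi a = 0; last exact: idealr0.
    by apply/phi_eq0; exists 1; rewrite ?idealr1 ?mul1r.
  (* Beyond [k] the chain [p] is unconstrained, whereas [extend_prime] wants every member between
     [I] and [m]; so the chain is made constant from [k] on. *)
  pose q i := p (minn i k).
  have Iq i : {subset I <= q i}.
    by move=> a /Ip; apply: (prime_chain_sub (j := minn i k) pch); rewrite geq_minr.
  have qm i : {subset q i <= m}.
    by move=> a aq; apply/pm/(prime_chain_sub (i := minn i k) pch _ aq); rewrite geq_minr leqnn.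
  exists (fun i => extend_prime (Iq i) (@qm i)) => i lti.
  have [sub nsub] := pch i lti.
  have qi : q i = p i by rewrite /q (minn_idPl (ltnW lti)).
  have qi1 : q i.+1 = p i.+1 by rewrite /q (minn_idPl lti).
  split=> [b /extendP[r [t [rq tm e]]]|subB].
    by apply/extendP; exists r, t; split; rewrite // qi1 sub // -qi.
  apply: nsub => a; rewrite -qi1 -qi => aq.
  by rewrite -(mem_extend_prime (Iq i) (@qm i)) subB // mem_extend_prime.
by split=> -[/eqS nS nmax]; split=> // k /eqS/nmax.
Qed.

End Local.

Section IdealQuotient.
Variables (R : comNzRingType) (I : idealr R).
Local Notation A := {ideal_quot I}.
Local Notation pi := (\pi_A).
Local Notation piR := (\pi_A : {rmorphism R -> A}).

(** For an ideal [J] containing [I], the choice of representative does not matter. *)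
Definition quot_pred (J : {pred R}) : {pred A} := fun x => repr x \in J.

Lemma mem_quot_pred (J : idealr R) a : {subset I <= J} ->
  (pi a \in quot_pred J) = (a \in J).
Proof.
move=> IJ; rewrite unfold_in /quot_pred.
have aJ : repr (pi a) - a \in J by apply: IJ; rewrite Quotient.idealrBE reprK.
by have := rpredDl a aJ; rewrite subrK.
Qed.

Lemma quot_closed (J : idealr R) : {subset I <= J} -> idealr_closed (quot_pred J).
Proof.
move=> IJ; split.
- by rewrite -(rmorph0 pi) mem_quot_pred // idealr0.
- by rewrite -(rmorph1 pi) mem_quot_pred // idealr1.
move=> x; elim/quotW: x => a u; elim/quotW: u => b v; elim/quotW: v => c.
rewrite -rmorphM -rmorphD !mem_quot_pred //; exact: idealr_ideal_closed.
Qed.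

Lemma quot_prime_closed (P : prime_idealr R) : {subset I <= P} ->
  prime_idealr_closed (quot_pred P).
Proof.
move=> IP; elim/quotW=> a; elim/quotW=> b.
by rewrite -rmorphM !mem_quot_pred // prime_idealrM.
Qed.

Lemma comap_idealr_closed (J : idealr A) : idealr_closed (comap_pred piR J).
Proof.
split; rewrite ?mem_comap_pred ?rmorph0 ?idealr0 ?rmorph1 ?idealr1 //.
move=> a u v; rewrite !mem_comap_pred rmorphD rmorphM => uP vP.
exact: idealr_ideal_closed.
Qed.

Lemma cohen_macaulay_local_quotient (M : prime_idealr A) (m : prime_idealr R) :
    (forall r, (pi r \in M) = (r \in m)) ->
  cohen_macaulay_local (localization M) <->
  exists2 n, is_maximum (fun k => exists2 s, size s = k & locally_regular I m s) n
           & is_maximum (fun k => exists p, primes_between I m p k) n.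
Proof.
move=> Mm; pose phi : {rmorphism R -> localization M} := @to_loc A M \o piR.
have Im : {subset I <= m}.
  by move=> a; rewrite -Mm -pi_eq0 => /eqP->; apply: idealr0.
have phi_eq0 r : phi r = 0 <-> exists2 t, t \notin m & t * r \in I.
  split=> [/to_loc_eq0[t]|[t tm tr]].
    elim/quotW: t => t; rewrite Mm => tm /eqP; rewrite -rmorphM pi_eq0.
    by exists t.
  apply/to_loc_eq0; exists (pi t); rewrite ?Mm //; apply/eqP.
  by rewrite -rmorphM pi_eq0.
have phi_frac b : exists r t, t \notin m /\ phi t * b = phi r.
  have [a [t []]] := to_loc_frac b; elim/quotW: a => a; elim/quotW: t => t.
  by rewrite Mm; exists a, t.
have phi_unit t : t \notin m -> exists b, phi t * b = 1.
  by rewrite -Mm; apply: to_loc_unit.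
split=> [CM|[n dn kn] N /(depth_local Im phi_eq0 phi_frac phi_unit) dN].
  have max := @local_max_maximal _ _ phi _ _ Im phi_eq0 phi_frac phi_unit.
  have [n /(depth_local Im phi_eq0 phi_frac phi_unit _ max) dn] := CM _ max.
  by move=> /(krull_dim_local phi_eq0 phi_frac phi_unit); exists n.
exists n; first exact/dN.
exact/(krull_dim_local phi_eq0 phi_frac phi_unit).
Qed.

Lemma cohen_macaulay_idealP :
  cohen_macaulay_ideal I <->
  forall m : prime_idealr R, {subset I <= m} -> maximal_ideal m ->
  exists2 n, is_maximum (fun k => exists2 s, size s = k & locally_regular I m s) n
           & is_maximum (fun k => exists p, primes_between I m p k) n.
Proof.
split=> [CM m Im mmax|CM M Mmax].
  pose M := to_prime (quot_closed Im) (quot_prime_closed Im).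
  apply/(@cohen_macaulay_local_quotient M); first by move=> r; apply: mem_quot_pred.
  apply: CM => J MJ; pose Jc := to_idealr (comap_idealr_closed J).
  have JE : Jc =i m.
    by apply: mmax => r rm; apply: MJ; rewrite [_ \in _]mem_quot_pred.
  elim/quotW=> a; rewrite [RHS]mem_quot_pred // -JE.
  by [].
apply/(@cohen_macaulay_local_quotient M (comap piR M)) => //.
have Im : {subset I <= comap piR M}.
  move=> a; rewrite -pi_eq0 => /eqP a0; have : pi a \in M by rewrite a0 idealr0.
  by [].
apply: CM => // J MJ; have IJ : {subset I <= J} by move=> a /Im/MJ.
pose Jq := to_idealr (quot_closed IJ).
have JE : Jq =i M.
  apply: Mmax; elim/quotW=> a aM; rewrite [_ \in _]mem_quot_pred //.
  exact: MJ.
by move=> a; rewrite [RHS]mem_comap -JE [RHS]mem_quot_pred.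
Qed.

Lemma maximal_ideal_inverse (m : prime_idealr R) r : maximal_ideal m -> r \notin m ->
  exists s, r * s - 1 \in m.
Proof.
move=> mmax rm; pose J : {pred R} := fun a => `[< exists s, a - r * s \in m >].
have JP a : reflect (exists s, a - r * s \in m) (a \in J) by apply: asboolP.
apply: contrapT => nos.
have idJ : idealr_closed J.
  split.
  - by apply/JP; exists 0; rewrite mulr0 subr0 idealr0.
  - by apply/JP => -[s rs]; apply: nos; exists s; rewrite -rpredN opprB.
  move=> a u v /JP[s us] /JP[t vt]; apply/JP; exists (a * s + t).
  have -> : a * u + v - r * (a * s + t) = a * (u - r * s) + (v - r * t) by ring.
  exact: idealr_ideal_closed.
have mJ : {subset m <= to_idealr idJ}.
  by move=> a am; apply/JP; exists 0; rewrite mulr0 subr0.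
by case/negP: rm; rewrite -(mmax _ mJ); apply/JP; exists 1; rewrite mulr1 subrr idealr0.
Qed.

End IdealQuotient.

(** * Residue fields of polynomial rings *)

Lemma mpoly_ring_ind (K : fieldType) d (P : {mpoly K[d]} -> Prop) :
    (forall c, P c%:MP) -> (forall i, P 'X_i) ->
    (forall a b, P a -> P b -> P (a + b)) -> (forall a b, P a -> P b -> P (a * b)) ->
  forall a, P a.
Proof.
move=> PC PX PD PM a; rewrite [a]mpolyE.
elim/big_ind: _ => [||m _]; [by rewrite -mpolyC0 | exact: PD |].
rewrite -mul_mpolyC; apply: (PM) => //; rewrite mpolyXE_id.
elim/big_ind: _ => [||i _]; [by rewrite -mpolyC1 | exact: PM |].
by elim: (m i) => [|k IH]; rewrite ?expr0 -?mpolyC1 // exprS; apply: (PM).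
Qed.

Lemma mpoly_hom_ext (K : fieldType) d (B : nzRingType) (f g : {rmorphism {mpoly K[d]} -> B}) :
  (forall c, f c%:MP = g c%:MP) -> (forall i, f 'X_i = g 'X_i) -> f =1 g.
Proof.
move=> eC eX; apply: mpoly_ring_ind => // a b ea eb.
  by rewrite !rmorphD ea eb.
by rewrite !rmorphM ea eb.
Qed.

Section PolyVal.
Variables (K : fieldType) (d : nat).
Local Notation R := {mpoly K[d]}.
Variable h : 'I_d -> {poly R}.

Definition polyC2 : {rmorphism K -> {poly R}} := @polyC R \o @mpolyC d K.

(** For suitable [h] this views a polynomial as one in a single element [w] of [R]; evaluation at
    [w] undoes it. *)
Definition polyval : R -> {poly R} := mmap polyC2 h.

HB.instance Definition _ := GRing.RMorphism.copy polyval (mmap polyC2 h).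

Lemma polyvalC c : polyval c%:MP = c%:MP%:P.
Proof. by rewrite /polyval mmapC. Qed.

Lemma polyvalX i : polyval 'X_i = h i.
Proof. by rewrite /polyval mmapX mmap1U. Qed.

Lemma horner_polyval w : (forall i, (h i).[w] = 'X_i) -> forall a, (polyval a).[w] = a.
Proof.
move=> hw; apply: mpoly_ring_ind => [c|i|a b ea eb|a b ea eb].
- by rewrite polyvalC hornerC.
- by rewrite polyvalX.
- by rewrite rmorphD hornerD; exact: (congr2 +%R ea eb).
- by rewrite rmorphM hornerM; exact: (congr2 *%R ea eb).
Qed.

End PolyVal.

Section Integral.
Variables (R L : comNzRingType) (rho : {rmorphism R -> L}).

(** For [p] of degree [n.+1] with leading coefficient [l], multiplying the equation of [x] by the
    [n]-th power of [l] makes it a monic equation for [l * x]; its polynomial is [q]. *)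
Lemma integral_lead_coef (p : {poly R}) x : (1 < size p)%N ->
  root (map_poly rho p) x -> integralOver rho (rho (lead_coef p) * x).
Proof.
move=> sp /eqP; case sn: (size p) sp => [|[|n]] // _.
rewrite (@horner_coef_wide _ n.+2); last by rewrite -sn size_poly.
rewrite big_ord_recr /= coef_map /= => px0.
have lE : lead_coef p = p`_n.+1 by rewrite lead_coefE sn.
pose q := \poly_(k < n.+2) (if k == n.+1 then 1 else p`_k * lead_coef p ^+ (n - k)).
have q_n : q`_n.+1 = 1 by rewrite coef_poly ltnSn eqxx.
have sq : size q = n.+2.
  by apply: size_poly_eq; rewrite eqxx oner_eq0.
exists q; first by rewrite monicE lead_coefE sq q_n.
apply/eqP; rewrite (@horner_coef_wide _ n.+2); last by rewrite -sq size_poly.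
rewrite big_ord_recr /= coef_map /= q_n rmorph1 mul1r.
set l := lead_coef p in lE q q_n sq *.
have -> : \sum_(i < n.+1) (map_poly rho q)`_i * (rho l * x) ^+ i
   = rho l ^+ n * \sum_(i < n.+1) (map_poly rho p)`_i * x ^+ i.
  rewrite mulr_sumr; apply: eq_bigr => i _; rewrite !coef_map coef_poly /=.
  rewrite ltnS ltnW // ltn_eqF // rmorphM rmorphXn exprMn.
  have -> : rho l ^+ n = rho l ^+ (n - i) * rho l ^+ i.
    by rewrite -exprD subnK // -ltnS.
  ring.
transitivity (rho l ^+ n * (\sum_(i < n.+1) (map_poly rho p)`_i * x ^+ i + rho l * x ^+ n.+1)).
  by rewrite exprMn exprS; ring.
by rewrite lE px0 mulr0.
Qed.

End Integral.

(** * Zariski's lemma *)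

Section Zariski.
Variables (K : fieldType) (d : nat).
Local Notation R := {mpoly K[d]}.
Variable m : prime_idealr R.
Hypothesis mmax : maximal_ideal m.
Local Notation L := {ideal_quot m}.
Local Notation pi := (\pi_L : {rmorphism R -> L}).
Implicit Types (W : {set 'I_d}) (a b f : R).

Lemma killXi W i : kill W 'X_i = if i \in W then 0 else 'X_i :> R.
Proof. by rewrite /kill mmapX mmap1U. Qed.

Lemma killC W c : kill W c%:MP = c%:MP :> R.
Proof. by rewrite /kill mmapC. Qed.

Lemma kill_setT a : kill setT a = (a@_0%MM)%:MP.
Proof.
apply/mpolyP => k; rewrite mcoeff_kill mcoeffC; case: ifPn => [/exists_inP[j _ kj]|kT].
  have /negPf-> : k != 0%MM by apply: contraNneq kj => ->; rewrite mnm0E.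
  by rewrite mulr0.
have -> : k = 0%MM.
  apply/mnmP => j; rewrite mnm0E; apply/eqP; apply: contraR kT => kj.
  by apply/exists_inP; exists j.
by rewrite eqxx mulr1.
Qed.

Definition rhoW W : {rmorphism R -> L} := pi \o kill (~: W).

(** The variables in [W] are algebraically independent modulo [m]. The polynomials in these
    variables are encoded as the values, or fixed points, of [kill (~: W)]. *)
Definition transcendental W := forall a, kill (~: W) a \in m -> kill (~: W) a = 0.

Lemma transcendental0 : transcendental set0.
Proof.
move=> a; rewrite setC0 kill_setT => am; have [->|a0] := eqVneq a@_0%MM 0.
  exact: mpolyC0.
have : 1 \in m.
  have -> : 1 = (a@_0%MM)^-1%:MP * (a@_0%MM)%:MP :> R by rewrite -mpolyCM mulVf // mpolyC1.
  exact: idealMr.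
by rewrite idealr1.
Qed.

Lemma pi_eq0m a : (pi a == 0) = (a \in m). Proof. exact: pi_eq0. Qed.

Section Max.
Variable W : {set 'I_d}.
Hypothesis trW : transcendental W.
Hypothesis maxW : forall i, i \notin W -> ~ transcendental (i |: W).

(** For [i] outside [W], maximality gives a nonzero relation modulo [m] in the variables of
    [i |: W]. Its leading coefficient in ['X_i] involves only [W], hence is not in [m], and serves
    as the denominator [q]. *)
Lemma var_integral i : exists q : R, [/\ kill (~: W) q = q, q \notin m &
  integralOver (rhoW W) (pi (q * 'X_i))].
Proof.
have [iW|iW] := boolP (i \in W).
  exists 1; rewrite rmorph1 idealr1 mul1r; split=> //.
  have -> : pi 'X_i = rhoW W 'X_i by rewrite /rhoW /= killXi inE iW.
  exact: integral_id.
have [a [am a0]] : exists a, kill (~: (i |: W)) a \in m /\ kill (~: (i |: W)) a != 0.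
  apply: contrapT => noa; apply: (maxW iW) => a am; apply/eqP; apply: contraT => a0.
  by case: noa; exists a.
set b := kill _ a in am a0.
pose h (j : 'I_d) : {poly R} := if j == i then 'X else ('X_j)%:P.
have hi c : (polyval h c).['X_i] = c.
  apply: horner_polyval => j; rewrite /h; case: eqP => [->|_]; first by rewrite hornerX.
  by rewrite hornerC.
pose p := polyval h b.
have pfix : map_poly (kill (~: W)) p = p.
  have := @mpoly_hom_ext K d _ (map_poly (kill (~: W)) \o (polyval h \o kill (~: (i |: W))))
    (polyval h \o kill (~: (i |: W))).
  apply=> [c|j] /=; first by rewrite killC polyvalC map_polyC /= killC.
  rewrite killXi !inE; case: ifPn => [_|]; first by rewrite !rmorph0.
  rewrite negbK => jW; rewrite polyvalX /h.
  case: eqP jW => [->|_] /= jW; first by rewrite map_polyX.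
  by rewrite map_polyC /= killXi inE jW.
have p0 : p != 0 by apply: contraNneq a0 => p0; rewrite -[b]hi -/p p0 horner0.
have lfix : kill (~: W) (lead_coef p) = lead_coef p.
  by rewrite -[in RHS]pfix lead_coefE -coef_map pfix.
have lm : lead_coef p \notin m.
  by apply/negP => lm; case/eqP: p0; apply/eqP; rewrite -lead_coef_eq0 -lfix trW // lfix.
have rhop : map_poly (rhoW W) p = map_poly pi p by rewrite map_poly_comp pfix.
have px : root (map_poly (rhoW W) p) (pi 'X_i).
  by rewrite rhop /root horner_map hi pi_eq0m.
have sp : (1 < size p)%N.
  rewrite ltnNge; apply/negP => /size1_polyC pC; case/negP: lm.
  by rewrite pC lead_coefC -(hornerC p`_0 'X_i) -pC hi.
exists (lead_coef p); split=> //.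
have := integral_lead_coef sp px; rewrite {1}/rhoW /= lfix -rmorphM.
by [].
Qed.

Lemma denominators_integral : exists q : R, [/\ kill (~: W) q = q, q \notin m &
  forall a, exists N, integralOver (rhoW W) (pi (q ^+ N * a))].
Proof.
have /fin_all_exists[q qP] := var_integral.
exists (\prod_i q i); split.
- by rewrite rmorph_prod; apply: eq_bigr => i _; case: (qP i).
- elim/big_rec: _ => [|i x _ xm]; first by rewrite idealr1.
  by rewrite prime_idealrM negb_or xm andbT; case: (qP i).
set Q := \prod_i q i.
have Qfix : kill (~: W) Q = Q.
  by rewrite rmorph_prod; apply: eq_bigr => i _; case: (qP i).
have intK b : kill (~: W) b = b -> integralOver (rhoW W) (pi b).
  by move=> bfix; rewrite -bfix; apply: (integral_id (rhoW W)).
have up N N' a : integralOver (rhoW W) (pi (Q ^+ N * a)) ->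
    integralOver (rhoW W) (pi (Q ^+ (N' + N) * a)).
  move=> iN; rewrite exprD -mulrA (rmorphM pi); apply: integral_mul iN.
  by apply: intK; rewrite rmorphXn /= Qfix.
apply: mpoly_ring_ind => [c|i|a b [N iN] [N' iN']|a b [N iN] [N' iN']].
- by exists 0%N; rewrite mul1r; apply: intK; rewrite killC.
- exists 1%N; rewrite expr1 /Q (bigD1 i) //= mulrAC (rmorphM pi).
  have [_ _ iq] := qP i; apply: integral_mul iq _; apply: intK.
  by rewrite rmorph_prod; apply: eq_bigr => j _; case: (qP j).
- exists (N + N')%N; rewrite mulrDr (rmorphD pi); apply: integral_add (up _ N _ iN').
  by rewrite addnC; exact: up.
exists (N + N')%N.
have -> : Q ^+ (N + N') * (a * b) = (Q ^+ N * a) * (Q ^+ N' * b) by rewrite exprD; ring.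
by rewrite (rmorphM pi); exact: integral_mul iN iN'.
Qed.

(** For [j] in [W], let [w = 1 + 'X_j * q]. Its inverse modulo [m] is integral over the polynomials
    in [W] up to a power of [q], so [w] divides a power of [q]. Being 1 modulo [q], it is then a
    unit, hence constant, which is absurd. *)
Lemma transcendental_eq0 : W = set0.
Proof.
have [q [qfix qm qint]] := denominators_integral.
apply/eqP; rewrite -[_ == _]negbK; apply/negP => /set0Pn[j jW].
have q0 : q != 0 by apply: contraNneq qm => ->; apply: idealr0.
pose w := 1 + 'X_j * q.
have wfix : kill (~: W) w = w.
  by rewrite rmorphD rmorph1 rmorphM /= qfix killXi inE jW.
have killw : kill [set j] w = 1.
  by rewrite rmorphD rmorph1 rmorphM /= killXi inE eqxx mul0r addr0.
have wm : w \notin m.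
  apply/negP => wm; have := oner_eq0 R; rewrite -killw.
  by rewrite -[w]wfix trW ?wfix // rmorph0 eqxx.
have [y wy] := maximal_ideal_inverse mmax wm.
have [N [P Pmon /eqP Py]] := qint y.
have [v wv] : exists v, w * v = q ^+ (N * (size P).-1).
  case sP: (size P) => [|n].
    by move/eqP: sP; rewrite size_poly_eq0 => /eqP P0; move: Pmon;
       rewrite P0 monicE lead_coef0 eq_sym oner_eq0.
  move: Py; rewrite (@horner_coef_wide _ n.+1); last by rewrite -sP size_poly.
  move=> Py /=.
  (* This is the integral equation of [q ^+ N * y] times [w ^+ n], freed of [y] by [w * y = 1]
     modulo [m]. By transcendence it holds exactly, and all its terms but the last are divisible by
     [w]. *)
  pose E := \sum_(k < n.+1) P`_k * q ^+ (N * k) * w ^+ (n - k).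
  have wy1 : pi w * pi y = 1.
    by apply/eqP; rewrite -subr_eq0 -rmorphM -(rmorph1 pi) -rmorphB pi_eq0m.
  have /trW : kill (~: W) E \in m.
    rewrite -pi_eq0m -[X in X == _]/(rhoW W E); apply/eqP.
    rewrite -[RHS](mulr0 (pi w ^+ n)) -[in RHS]Py mulr_sumr rmorph_sum.
    apply: eq_bigr => k _; rewrite coef_map !rmorphM !rmorphXn /= qfix wfix.
    have -> : pi w ^+ n = pi w ^+ (n - k) * pi w ^+ k.
      by rewrite -exprD subnK // -ltnS.
    have wyk : pi w ^+ k * pi y ^+ k = 1 by rewrite -exprMn wy1 expr1n.
    rewrite !exprMn -exprM.
    rewrite -[LHS]mulr1 -wyk; ring.
  rewrite /E big_ord_recr /= subnn expr0 mulr1.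
  have -> : P`_n = 1 by move: Pmon; rewrite monicE lead_coefE sP => /eqP.
  rewrite mul1r => E0.
  exists (- \sum_(k < n) kill (~: W) P`_k * q ^+ (N * k) * w ^+ (n - k.+1)).
  move: E0; rewrite rmorphD rmorph_sum rmorphXn /= qfix => /eqP.
  rewrite addrC addr_eq0 => /eqP->; rewrite mulrN mulr_sumr; congr (- _).
  apply: eq_bigr => k _; rewrite !rmorphM !rmorphXn /= qfix wfix.
  by rewrite -(subnSK (ltn_ord k)) exprS; ring.
move: wv; set M := (N * _)%N => wv.
have [u wu] : exists u, w * u = 1.
  (* The geometric sum inverts [w] up to the [M]-th power of [- ('X_j * q)], which is a multiple of
     [q ^+ M = w * v]. *)
  exists (\sum_(i < M) 1 ^+ (M.-1 - i) * (- ('X_j * q)) ^+ i + (- 'X_j) ^+ M * v).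
  have := subrXX 1 (- ('X_j * q)) M; rewrite expr1n opprK -/w => e.
  have {}e : 1 = w * (\sum_(i < M) 1 ^+ (M.-1 - i) * (- ('X_j * q)) ^+ i)
                 + (- ('X_j * q)) ^+ M by rewrite -e subrK.
  rewrite mulrDr mulrCA wv [RHS]e; congr (_ + _).
  by rewrite -exprMn mulNr.
have w0 : w != 0 by apply: contraNneq wm => ->; apply: idealr0.
have u0 : u != 0 by apply: contra_eq_neq wu => ->; rewrite mulr0 eq_sym oner_neq0.
have : msize (w * u) = 1%N by rewrite wu msize1.
rewrite msizeM // => sz.
have /msize_poly1P[c c0 wc] : msize w == 1%N.
  move: w0 u0; rewrite -!msize_poly_eq0 -!lt0n; move: sz.
  by case: (msize w) => [|[|k]] //; case: (msize u) => // k'; rewrite addnS /= !addSn.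
have c1 : c%:MP = 1 :> R by rewrite -killw wc killC.
have : 'X_j * q == 0 by rewrite -[_ * _](addKr 1) -/w wc c1 addNr.
rewrite mulf_eq0 (negPf q0) orbF => /eqP/(congr1 (fun f => msize f)).
by rewrite msizeX msize0.
Qed.

End Max.

(** A maximal transcendental [W] is empty, so the denominators are nonzero constants and [f] is
    integral over [K] modulo [m]. *)
Lemma zariski f : exists2 g : {poly K}, g \is monic &
  (map_poly (@mpolyC d K) g).[f] \in m.
Proof.
have [W trW maxW] : exists2 W, transcendental W &
    forall i, i \notin W -> ~ transcendental (i |: W).
  have ex : exists W, `[< transcendental W >].
    by exists set0; apply/asboolP/transcendental0.
  have [W /maxsetP[/asboolP trW Wmax]] := ex_maxset ex.
  exists W => // i iW /asboolP tr; case/negP: iW.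
  by rewrite -(Wmax _ tr (subsetUr _ _)) !inE eqxx.
have W0 := transcendental_eq0 trW maxW; rewrite {}W0 in trW maxW.
have [q [qfix qm qint]] := denominators_integral trW maxW.
have [N] := qint f; rewrite setC0 kill_setT in qfix.
have q0 : q@_0%MM != 0.
  by apply: contraNneq qm => q0; rewrite -qfix q0 mpolyC0; apply: idealr0.
set c := q@_0%MM in qfix q0; rewrite -qfix => fint.
have : integralOver (rhoW set0) (pi ((c^-1 ^+ N)%:MP * (c%:MP ^+ N * f))).
  rewrite (rmorphM pi); apply: integral_mul _ fint.
  have -> : pi (c^-1 ^+ N)%:MP = rhoW set0 (c^-1 ^+ N)%:MP by rewrite /rhoW /= killC.
  exact: integral_id.
have -> : (c^-1 ^+ N)%:MP * (c%:MP ^+ N * f) = f.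
  by rewrite mulrA -(rmorphXn (@mpolyC d K)) -mpolyCM -exprMn mulVf // expr1n mpolyC1 mul1r.
move=> [P Pmon /eqP Pf].
pose ev : {rmorphism R -> K} := mcoeff 0%MM.
exists (map_poly ev P); first exact: monic_map.
rewrite -pi_eq0m -[X in X == 0]/(pi _) -horner_map -map_poly_comp -map_poly_comp.
apply/eqP; rewrite -[RHS]Pf; congr (_.[_]); apply: eq_map_poly => a /=.
by rewrite setC0 kill_setT.
Qed.

End Zariski.

(** * Regular sequences *)

(* [R] is viewed as a polynomial ring in the variable [w] over the subring of the
   [b] with [tau b = b%:P]; division by [tau f] is linear over this subring. *)
Section MonicDivision.
Variables (R : idomainType) (tau : {rmorphism R -> {poly R}}) (w : R).
Hypothesis tauK : forall a, (tau a).[w] = a.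
Variables (f : R) (s : seq R).
Hypothesis monic_f : tau f \is monic.
Hypothesis const_s : {in s, forall b, tau b = b%:P}.

Let ulc : lead_coef (tau f) \is a GRing.unit.
Proof. by rewrite (monicP monic_f) unitr1. Qed.

Let quo a := (tau a %/ tau f).[w].
Let rem a := (tau a %% tau f).[w].

Lemma division_eq a : a = quo a * f + rem a.
Proof.
rewrite -[LHS]tauK (Pdiv.IdomainUnit.divp_eq ulc (tau a)).
by rewrite hornerD hornerM tauK.
Qed.

Lemma linear_span (g : R -> R) : (forall a b, g (a + b) = g a + g b) ->
    (forall b a, tau b = b%:P -> g (b * a) = b * g a) ->
  forall a, a \in ideal_span s -> g a \in ideal_span s.
Proof.
move=> gD gM a /ideal_spanP[c ->].
have g0 : g 0 = 0 by apply: (addrI (g 0)); rewrite -gD !addr0.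
apply/ideal_spanP; exists (fun i => g (c i)).
rewrite (big_morph g gD g0); apply: eq_bigr => i _.
by rewrite mulrC gM 1?mulrC //; apply/const_s/mem_nth.
Qed.

Lemma rem_span a : a \in ideal_span s -> rem a \in ideal_span s.
Proof.
apply: linear_span => [b c|b c bP]; rewrite /rem.
  by rewrite rmorphD (Pdiv.IdomainUnit.modpD ulc) hornerD.
by rewrite rmorphM bP mul_polyC (Pdiv.IdomainUnit.modpZl ulc) hornerZ.
Qed.

Lemma quo_span a : a \in ideal_span s -> quo a \in ideal_span s.
Proof.
apply: linear_span => [b c|b c bP]; rewrite /quo.
  by rewrite rmorphD (Pdiv.IdomainUnit.divpD ulc) hornerD.
by rewrite rmorphM bP mul_polyC (Pdiv.IdomainUnit.divpZl ulc) hornerZ.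
Qed.

Lemma monic_regular : regular_mod (ideal_span s) f.
Proof.
move=> a /quo_span; rewrite /quo rmorphM (Pdiv.IdomainUnit.mulKp ulc) tauK.
by [].
Qed.

(** Taking remainders by [f] turns [h * a] into [h * rem a] and removes multiples of [f]; so [rem a]
    is in the span of [s], and [a] differs from it by a multiple of [f]. *)
Lemma regular_rcons_monic h : tau h = h%:P ->
  regular_mod (ideal_span s) h -> regular_mod (ideal_span (rcons s f)) h.
Proof.
move=> hP reg a /ideal_span_rcons[c /rem_span].
rewrite /rem rmorphB rmorphM rmorphM hP mul_polyC (Pdiv.IdomainUnit.modpD ulc).
rewrite (Pdiv.IdomainUnit.modpN ulc) (Pdiv.IdomainUnit.modpZl ulc).
have -> : (tau c * tau f) %% tau f = 0.
  by rewrite -[_ * _]addr0 (Pdiv.IdomainUnit.modp_addl_mul_small ulc) ?size_poly0 //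
     size_poly_gt0 -lead_coef_eq0 (monicP monic_f) oner_neq0.
rewrite subr0 hornerZ => /reg ra.
apply/ideal_span_rcons; exists (quo a).
by rewrite [X in X - _](division_eq a) addrC addrA addNr add0r.
Qed.

End MonicDivision.

(** * Powers of locally regular sequences *)

Section SaturationPowers.
Variables (R : comNzRingType) (I : idealr R) (m : prime_idealr R).
Implicit Types (s t : seq R) (a c x y : R).
Local Notation sat t := (saturation I m (ideal_span t)).

Lemma sat_closed t : ideal_closed (sat t).
Proof.
move=> a u v /saturationP[u1 [z1 [u1m z1t e1]]] /saturationP[u2 [z2 [u2m z2t e2]]].
apply/saturationP; exists (u1 * u2), (a * u2 * z1 + u1 * z2); split.
- exact: notin_primeM.
- by apply: ideal_span_closed => //; apply: ideal_closedM => //; exact: ideal_span_closed.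
have -> : u1 * u2 * (a * u + v) - (a * u2 * z1 + u1 * z2)
  = a * u2 * (u1 * u - z1) + u1 * (u2 * v - z2) by ring.
by rewrite rpredD // idealMr.
Qed.

Lemma sat_unit t u a : u \notin m -> u * a \in sat t -> a \in sat t.
Proof.
move=> um /saturationP[v [z [vm zt e]]]; apply/saturationP; exists (v * u), z.
by rewrite notin_primeM // -mulrA.
Qed.

Lemma sat_rcons t x a : reflect (exists u c, u \notin m /\ u * a - c * x \in sat t)
  (a \in sat (rcons t x)).
Proof.
apply: (iffP (saturationP _ _ _ _)) => [[u [z [um /ideal_span_rcons[c zt] e]]]|].
  exists u, c; split=> //; apply/saturationP; exists 1, (z - c * x).
  by rewrite idealr1; have -> : 1 * (u * a - c * x) - (z - c * x) = u * a - z by ring.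
move=> [u [c [um /saturationP[v [z [vm zt e]]]]]].
exists (v * u), (z + v * c * x); split; first exact: notin_primeM.
  by apply/ideal_span_rcons; exists (v * c); rewrite addrK.
by have -> : v * u * a - (z + v * c * x) = v * (u * a - c * x) - z by ring.
Qed.

Lemma eq_sat t t' : t =i t' -> sat t =i sat t'.
Proof.
move=> tt' a; apply/saturationP/saturationP => -[u [z [um zt e]]]; exists u, z;
  split=> //; by rewrite ?(eq_ideal_span tt') // -(eq_ideal_span tt').
Qed.

Lemma sat_sub t t' : {subset t <= t'} -> {subset sat t <= sat t'}.
Proof.
move=> tt' a /saturationP[u [z [um zt e]]]; apply/saturationP; exists u, z.
by split=> //; apply: ideal_span_sub zt.
Qed.

Lemma mem_sat t x : x \in t -> x \in sat t.
Proof. by move=> xt; apply/saturation_sub/mem_ideal_span. Qed.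

Lemma sat_powS t x N a : a \in sat (rcons t (x ^+ N)) -> x * a \in sat (rcons t (x ^+ N.+1)).
Proof.
move=> /sat_rcons[u [c [um e]]]; apply/sat_rcons; exists u, c; split=> //.
have -> : u * (x * a) - c * x ^+ N.+1 = x * (u * a - c * x ^+ N) by rewrite exprS; ring.
exact/ideal_closedM/e/sat_closed.
Qed.

Lemma sat_pow_sub t x N : {subset sat (rcons t (x ^+ N.+1)) <= sat (rcons t x)}.
Proof.
move=> a /sat_rcons[u [c [um e]]]; apply/sat_rcons; exists u, (c * x ^+ N).
by split=> //; rewrite -mulrA -exprSr.
Qed.

Section Power.
Variables (t s : seq R) (x : R).
Hypothesis reg_x : regular_mod (sat t) x.
Hypothesis reg_s : forall i, (i < size s)%N ->
  regular_mod (sat (rcons (t ++ take i s) x)) s`_i.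

Lemma sat_div_x N i c : (i <= size s)%N ->
  x * c \in sat (rcons (t ++ take i s) (x ^+ N.+1)) ->
  c \in sat (rcons (t ++ take i s) (x ^+ N)).
Proof.
elim: i c => [|i IH] c.
  rewrite take0 cats0 => _ /sat_rcons[u [b [um e]]]; apply/sat_rcons; exists u, b.
  split=> //; apply: reg_x.
  by have -> : x * (u * c - b * x ^+ N) = u * (x * c) - b * x ^+ N.+1
    by rewrite exprS; ring.
move=> lti; set q := t ++ take i s; set y := s`_i.
have swap M : sat (rcons (t ++ take i.+1 s) (x ^+ M)) =i sat (rcons (rcons q (x ^+ M)) y).
  apply: eq_sat => b; rewrite (take_nth 0 lti) -rcons_cat.
  by rewrite !(mem_rcons, inE) orbCA.
rewrite !swap => /sat_rcons[u [e [um ye]]].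
have /(reg_s lti) : y * e \in sat (rcons q x).
  have xM : x * (u * c) \in sat (rcons q x).
    rewrite mulrC; apply: ideal_closedM; first exact: sat_closed.
    by apply: mem_sat; rewrite mem_rcons inE eqxx.
  have -> : y * e = (-1) * (u * (x * c) - e * y) + x * (u * c) by ring.
  by apply: sat_closed => //; apply: sat_pow_sub ye.
move=> /sat_rcons[v [e' [vm ve]]].
have : x * (v * u * c - y * e') \in sat (rcons q (x ^+ N.+1)).
  have -> : x * (v * u * c - y * e') = v * (u * (x * c) - e * y) + y * (v * e - e' * x) by ring.
  apply: sat_closed => //; apply: ideal_closedM; first exact: sat_closed.
  by apply: sat_sub ve => b bq; rewrite mem_rcons inE bq orbT.
move=> /(IH _ (ltnW lti)) h; apply/sat_rcons; exists (v * u), e'.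
by rewrite notin_primeM // [e' * y]mulrC.
Qed.

(** Induction on the exponent: if [y * a] vanishes modulo [q] and [x ^+ N.+2], then [a] is some
    [b * x] modulo [q], up to a unit. Cancelling [x] makes [y * b], hence [b], vanish for the
    exponent [N.+1]. *)
Lemma regular_after_power N i : (i < size s)%N ->
  regular_mod (sat (rcons (t ++ take i s) (x ^+ N.+1))) s`_i.
Proof.
move=> lti; elim: N => [|N IH]; first exact: reg_s.
move=> a; set q := t ++ take i s in IH *; set y := s`_i in IH * => ya.
have /sat_rcons[u [b [um e]]] : a \in sat (rcons q x).
  by apply: (reg_s lti); apply: sat_pow_sub ya.
have up M : {subset sat q <= sat (rcons q (x ^+ M))}.
  by apply: sat_sub => z zq; rewrite mem_rcons inE zq orbT.
have /(sat_div_x (ltnW lti))/IH bN : x * (y * b) \in sat (rcons q (x ^+ N.+2)).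
  have -> : x * (y * b) = - y * (u * a - b * x) + u * (y * a) by ring.
  apply: sat_closed; first exact: up.
  exact/ideal_closedM/ya/sat_closed.
apply: (sat_unit um).
have -> : u * a = 1 * (u * a - b * x) + x * b by ring.
by apply: sat_closed; [exact: up | exact: sat_powS].
Qed.

End Power.

Lemma sat_regular_pow N t s :
  (forall i, (i < size s)%N -> regular_mod (sat (t ++ take i s)) s`_i) ->
  forall i, (i < size s)%N ->
  regular_mod (sat (t ++ take i [seq x ^+ N.+1 | x <- s])) (s`_i ^+ N.+1).
Proof.
elim: s t => [//|x s IH] t reg i.
have reg_x : regular_mod (sat t) x by have := reg 0%N isT; rewrite cats0.
have reg_s j : (j < size s)%N -> regular_mod (sat (rcons (t ++ take j s) x)) s`_j.
  have eqt b : (b \in sat (t ++ x :: take j s)) = (b \in sat (rcons (t ++ take j s) x)).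
    by apply: eq_sat => z; rewrite mem_rcons !(mem_cat, inE) orbCA.
  by move=> ltj a; rewrite -!eqt; apply: (reg j.+1 ltj).
case: i => [_|i lti] /=.
  rewrite cats0; elim: N.+1 => [|M IHM] a; first by rewrite mul1r.
  by rewrite exprS -mulrA => /reg_x/IHM.
rewrite -cat_rcons; apply: IH => // j ltj a.
have eqt b : (b \in sat (rcons t (x ^+ N.+1) ++ take j s))
    = (b \in sat (rcons (t ++ take j s) (x ^+ N.+1))).
  by apply: eq_sat => z; rewrite !mem_rcons !(mem_cat, mem_rcons, inE) orbA.
rewrite !eqt; exact: regular_after_power.
Qed.

Lemma locally_regular_pow N s : locally_regular I m s ->
  locally_regular I m [seq x ^+ N.+1 | x <- s].
Proof.
move=> [sm reg]; split=> [_ /mapP[x /sm xm ->]|i].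
  by rewrite exprS mulrC idealMr.
rewrite size_map => lti; rewrite (nth_map 0) //.
exact: (@sat_regular_pow N [::]).
Qed.

Lemma locally_regular_flag s : locally_regular I m s ->
  regular_flag (sat [::]) s (sat s).
Proof.
move=> [_ reg]; rewrite -[in X in regular_flag _ _ X](take_size s) -{1}(take0 s).
apply: (@regular_flag_nat _ (fun i => sat (take i s))) => i lti.
split; [exact: reg | | | exact: sat_closed].
  by apply: sat_sub => x xs; rewrite (take_nth 0 lti) mem_rcons inE xs orbT.
by apply: mem_sat; rewrite (take_nth 0 lti) mem_rcons inE eqxx.
Qed.

Lemma locally_regular_proper s : {subset I <= m} -> locally_regular I m s ->
  1 \notin sat s.
Proof.
move=> Im [sm _]; apply/negP => /saturationP[u [z [um zs /Im]]]; rewrite mulr1 => uz.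
have zm : z \in m.
  move: z zs {uz}; apply: ideal_span_min sm; last exact: idealr0.
  exact: idealr_ideal_closed.
by have := rpredD uz zm; rewrite subrK (negPf um).
Qed.

End SaturationPowers.

(** * The Cohen-Macaulay property *)

Section Evaluation.
Variables (K : fieldType) (d : nat).
Local Notation R := {mpoly K[d]}.

Definition univariate (g : {poly K}) (z : R) : R := (map_poly (@mpolyC d K) g).[z].

Lemma rmorph_univariate (B : nzRingType) (f : {rmorphism R -> B}) g z :
  f (univariate g z) = (map_poly (f \o @mpolyC d K) g).[f z].
Proof. by rewrite /univariate -horner_map -map_poly_comp. Qed.

End Evaluation.

(** * Chains of primes below a maximal ideal *)

Section PrimeChain.
Variables (K : fieldType) (d : nat).
Local Notation R := {mpoly K[d]}.
Variable m : prime_idealr R.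
Hypothesis mmax : maximal_ideal m.
Local Notation L := {ideal_quot m}.
Local Notation pi := (\pi_L : {rmorphism R -> L}).
Implicit Types (E D : {set 'I_d}).

Lemma quotient_domain (x y : L) : x * y = 0 -> (x == 0) || (y == 0).
Proof. exact: Quotient.rquot_IdomainAxiom. Qed.

Lemma mpoly_quotient_domain (p q : {mpoly L[d]}) : p * q = 0 -> (p == 0) || (q == 0).
Proof.
move=> pq; have [//|p0 /=] := eqVneq p 0.
have reg : GRing.lreg (mleadc p).
  move=> x z e; apply/eqP; rewrite -subr_eq0.
  have /quotient_domain : mleadc p * (x - z) = 0 by rewrite mulrBr e subrr.
  by rewrite mleadc_eq0 (negPf p0).
by apply/eqP; apply: (lreg_mleadc reg); rewrite pq mulr0.
Qed.

Definition polyCL : {rmorphism K -> {mpoly L[d]}} :=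
  @mpolyC d L \o (pi \o @mpolyC d K).

(* The kernels of these homomorphisms into a polynomial ring over the residue
   field of [m] are the members of a chain of primes ending at [m]. *)
Definition spec E : R -> {mpoly L[d]} :=
  mmap polyCL (fun j => if j \in E then (pi 'X_j)%:MP else 'X_j).

HB.instance Definition _ E := GRing.RMorphism.copy (spec E)
  (mmap polyCL (fun j => if j \in E then (pi 'X_j)%:MP else 'X_j)).

Lemma specC E c : spec E c%:MP = (pi c%:MP)%:MP.
Proof. by rewrite /spec mmapC. Qed.

Lemma specX E j : spec E 'X_j = if j \in E then (pi 'X_j)%:MP else 'X_j.
Proof. by rewrite /spec mmapX mmap1U. Qed.

Definition spec_prime E : prime_idealr R :=
  to_prime (kernel_idealr_closed (spec E))
           (kernel_prime_closed (f := spec E) mpoly_quotient_domain).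

Lemma spec_primeP E a : reflect (spec E a = 0) (a \in spec_prime E).
Proof. exact: eqP. Qed.

Lemma spec_prime_sub E E' : E \subset E' -> {subset spec_prime E <= spec_prime E'}.
Proof.
move=> EE' a /spec_primeP a0; apply/spec_primeP.
pose g : {rmorphism {mpoly L[d]} -> {mpoly L[d]}} :=
  mmap (@mpolyC d L) (fun j => if j \in E' then (pi 'X_j)%:MP else 'X_j).
have -> : spec E' a = g (spec E a); last by rewrite a0 rmorph0.
apply: (@mpoly_hom_ext K d _ (spec E') (g \o spec E)) => [c|j] /=.
  by rewrite !specC mmapC.
rewrite !specX; have [jE|_] := boolP (j \in E).
  by rewrite (subsetP EE' _ jE) mmapC.
by rewrite mmapX mmap1U.
Qed.

Lemma spec_prime_le E : {subset spec_prime E <= m}.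
Proof.
move=> a /(spec_prime_sub (subsetT E))/spec_primeP.
have -> : spec setT a = (pi a)%:MP.
  apply: (@mpoly_hom_ext K d _ (spec setT) (@mpolyC d L \o pi)) => [c|j] /=.
    by rewrite specC.
  by rewrite specX inE.
by move=> /eqP; rewrite mpolyC_eq0 pi_eq0.
Qed.

(** By Zariski's lemma a monic polynomial in ['X_j] lies in [m], hence in the larger prime; for the
    smaller one ['X_j] is still an indeterminate, and the leading term survives. *)
Lemma spec_prime_proper E j : j \notin E ->
  ~ {subset spec_prime (j |: E) <= spec_prime E}.
Proof.
move=> jE; have [g gmon gm] := zariski mmax 'X_j.
have eqC E' : map_poly (spec E' \o @mpolyC d K) g = map_poly polyCL g.
  by apply: eq_map_poly => c /=; rewrite specC.
move=> /(_ (univariate g 'X_j)) sub.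
have /sub/spec_primeP : univariate g 'X_j \in spec_prime (j |: E).
  apply/spec_primeP; rewrite (rmorph_univariate (spec _)) eqC /= specX !inE eqxx /=.
  have -> : (map_poly polyCL g).[(pi 'X_j)%:MP]
      = (@mpolyC d L \o pi) (univariate g 'X_j).
    by rewrite rmorph_univariate.
  by apply/eqP; rewrite /= mpolyC_eq0 pi_eq0.
rewrite (rmorph_univariate (spec _)) eqC /= specX (negPf jE).
move=> /(congr1 (mcoeff (U_(j) *+ (size g).-1)%MM)).
have sg : (0 < size g)%N.
  by rewrite size_poly_gt0; apply: monic_neq0.
rewrite (@horner_coef_wide _ (size g)) ?size_poly // raddf_sum mcoeff0.
have last_lt : ((size g).-1 < size g)%N by rewrite ltn_predL.
rewrite (bigD1 (Ordinal last_lt)) //= big1 => [|k neq].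
  rewrite addr0 coef_map /= -lead_coefE (monicP gmon) mpolyC1 rmorph1 mpolyC1 mul1r.
  by rewrite mcoeffXn eqxx => /eqP; rewrite oner_eq0.
rewrite coef_map /= mul_mpolyC mcoeffZ mcoeffXn.
case: eqP => [e|_]; last by rewrite mulr0.
case/eqP: neq; apply: val_inj => /=; move/mnmP/(_ j): e.
by rewrite !mulmnE mnm1E eqxx !mul1n.
Qed.

Lemma spec_chain D : {in D, forall j, 'X_j \in m} ->
  exists p : nat -> prime_idealr R,
    [/\ prime_chain p #|~: D|, {subset coord_prime K D <= p 0%N} &
        {subset p #|~: D| <= m}].
Proof.
move=> Dm; have [F [F0 _ FS]] := set_chain (subsetT D); rewrite setTD in FS.
exists (fun i => spec_prime (F i)); split.
- move=> i /FS[j jF ->]; split; last exact: spec_prime_proper.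
  exact/spec_prime_sub/subsetU1.
- rewrite F0; apply: coord_prime_min => [||j jD].
  + exact: idealr_ideal_closed.
  + exact: idealr0.
  by apply/spec_primeP; rewrite specX jD; apply/eqP; rewrite mpolyC_eq0 pi_eq0 Dm.
exact: spec_prime_le.
Qed.

End PrimeChain.

(** * Depth at the origin *)

Section Origin.
Variables (K : fieldType) (d : nat) (T : rel 'I_d).
Local Notation R := {mpoly K[d]}.
Local Notation I := (closed_nbhd_ideal K T).
Local Notation m0 := (coord_prime K [set: 'I_d]).
Implicit Types (D : {set 'I_d}).

Lemma origin_maximal : maximal_ideal m0.
Proof.
move=> J mJ a; apply/idP/idP => [aJ|/mJ//].
rewrite coord_primeE kill_setT mpolyC_eq0; apply: contraT => a0.
have am : a - (a@_0%MM)%:MP \in m0.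
  by rewrite coord_primeE rmorphB /= killC kill_setT subrr.
have : 1 \in J.
  have -> : 1 = (a@_0%MM)^-1%:MP * (a@_0%MM)%:MP :> R by rewrite -mpolyCM mulVf // mpolyC1.
  apply: idealMr; have -> : (a@_0%MM)%:MP = a - (a - (a@_0%MM)%:MP) by ring.
  by rewrite rpredB // mJ.
by rewrite idealr1.
Qed.

Lemma origin_power a N : a \in m0 -> a ^+ N \in mono_ideal (fun k => (N <= mdeg k)%N).
Proof.
move=> /mono_idealP am; have am1 : {in msupp a, forall k, 0 < mdeg k}%N.
  move=> k /am/exists_inP[j _ kj]; rewrite lt0n mdeg_eq0.
  by apply: contraNneq kj => ->; rewrite mnm0E.
elim: N => [|N IH]; first by apply/mono_idealP.
apply/mono_idealP => k; rewrite exprS => /msuppM_le/allpairsP[[k1 k2] /= [k1a k2a ->]].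
by rewrite mdegD -add1n leq_add ?am1 //; apply: (mono_idealP _ _ IH).
Qed.

Lemma coefficient_outside D (a : R) : dominating T D -> a \in I ->
  a@_(mesym1 (~: D)) = 0.
Proof.
move=> /forallP Ddom /closed_nbhd_idealP aI; apply/eqP; rewrite mcoeff_eq0.
apply/negP => /aI[i im]; have /set0Pn[j /setIP[jD ji]] := Ddom i.
by have := forall_inP im j ji; rewrite mesym1_val inE jD.
Qed.

(** A [u] outside [m0] has a nonzero constant term, so the monomial of [~: D] occurs in
    [u * mono K (~: D)]. It occurs neither in the ideal, as [D] is dominating, nor in the span of
    [t], by degree. *)
Lemma mono_notin_saturation D (t : seq R) : dominating T D ->
  {subset t <= mono_ideal (fun k => #|~: D| < mdeg k)%N} ->
  mono K (~: D) \notin saturation I m0 (ideal_span t).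
Proof.
move=> Ddom tN; apply/negP => /saturationP[u [z [um zt uz]]].
have zN : z \in mono_ideal (fun k => #|~: D| < mdeg k)%N.
  move: z zt {uz}; apply: ideal_span_min tN; last exact: mono_ideal0.
  by apply: mono_ideal_closed => k k' kN; rewrite mdegD ltn_addr.
have := coefficient_outside Ddom uz; rewrite mcoeffB.
have -> : z@_(mesym1 (~: D)) = 0.
  apply/eqP; rewrite mcoeff_eq0; apply/negP => /(mono_idealP _ _ zN).
  by rewrite mdeg_mesym1 ltnn.
rewrite subr0 monoE -[X in _@_X]addm0 mcoeffMX => u0; case/negP: um.
by rewrite coord_primeE kill_setT u0 mpolyC0.
Qed.

Definition colon_saturation (t : seq R) (y : R) : {pred R} :=
  fun b => `[< b * y \in saturation I m0 (ideal_span t) >].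

Lemma colon_saturationP t y b :
  reflect (b * y \in saturation I m0 (ideal_span t)) (b \in colon_saturation t y).
Proof. exact: asboolP. Qed.

Lemma colon_saturation_closed t y : ideal_closed (colon_saturation t y).
Proof.
move=> a u v /colon_saturationP uJ /colon_saturationP vJ; apply/colon_saturationP.
by rewrite mulrDl -mulrA; apply: sat_closed.
Qed.

Lemma colon_saturation_flag t y : locally_regular I m0 t ->
  regular_flag (colon_saturation [::] y) t (colon_saturation t y).
Proof.
move=> [_ treg].
rewrite -[in X in regular_flag _ _ X](take_size t) -{1}(take0 t).
apply: (@regular_flag_nat _ (fun i => colon_saturation (take i t) y)) => i lti; split.
- move=> a /colon_saturationP; rewrite -mulrA => /(treg i lti) aJ.
  exact/colon_saturationP.
- move=> a /colon_saturationP aJ; apply/colon_saturationP; move: aJ.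
  by apply: sat_sub => x xt; rewrite (take_nth 0 lti) mem_rcons inE xt orbT.
- apply/colon_saturationP; rewrite mulrC; apply: ideal_closedM; first exact: sat_closed.
  by apply: mem_sat; rewrite (take_nth 0 lti) mem_rcons inE eqxx.
- exact: colon_saturation_closed.
Qed.

Lemma coord_prime_sub_colon D : minset (dominating T) D ->
  {subset coord_prime K D <= colon_saturation [::] (mono K (~: D))}.
Proof.
move=> Dmin a; rewrite -(mono_compl_annihilator _ Dmin) => ay.
apply/colon_saturationP; apply: sub_saturation ay; exact: ideal_span0.
Qed.

(* A minimal dominating set [D] yields an element annihilated by the prime of
   [D]. The relation from [long_seq_collapses] puts a unit multiple of it
   into the ideal of the powers of a regular sequence that is longer than the
   dimension of this prime, which is impossible for degree reasons. *)
Lemma depth_origin_le D s : minset (dominating T) D -> locally_regular I m0 s ->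
  (#|D| + size s <= d)%N.
Proof.
move=> Dmin sreg; have /minsetP[Ddom _] := Dmin; have [sm _] := sreg.
(* The exponent is one more than the degree of [mono K (~: D)]. *)
have treg := locally_regular_pow #|~: D| sreg.
have tN : {subset [seq x ^+ #|~: D|.+1 | x <- s]
                    <= mono_ideal (fun k => #|~: D| < mdeg k)%N}.
  by move=> _ /mapP[x xs ->]; apply: origin_power; apply: sm.
have uD := enum_uniq D.
have D0 : {in enum D, forall j, j \notin (set0 : {set 'I_d})} by move=> j; rewrite inE.
have fl := coord_flag K uD D0.
have DE : set0 :|: [set j in enum D] = D by apply/setP => j; rewrite !inE mem_enum.
rewrite DE in fl.
have := flag_bound fl (coord_prime_sub_colon Dmin) (colon_saturation_flag _ treg).
rewrite idealr0 !size_map -cardE; apply=> //.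
by apply/colon_saturationP; rewrite mul1r; apply/negP/mono_notin_saturation.
Qed.

End Origin.

Section Equivalences.
Variables (K : fieldType) (d : nat) (T : rel 'I_d).
Local Notation R := {mpoly K[d]}.
Local Notation N := (closed_nbhd T).
Local Notation I := (closed_nbhd_ideal K T).
Local Notation m0 := (coord_prime K [set: 'I_d]).

(** At the origin the depth is at most [d - #|D|] and the dimension at least [d - #|D|], for each
    minimal [D]; their equality fixes [#|D|]. *)
Lemma cohen_macaulay_domination : ssrbool.symmetric T ->
  cohen_macaulay_ideal (closed_nbhd_ideal K T) -> domination_unmixed T.
Proof.
move=> Tsym /cohen_macaulay_idealP CM.
have domT : dominating T setT.
  by apply/dominatingP => i; exists i; rewrite ?inE ?eqxx ?orbT.
have Im : {subset I <= m0} by exact: closed_nbhd_ideal_sub.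
have [n [[s sn sreg] _] [_ nmax]] := CM m0 Im (@origin_maximal K d).
suff card D : minset (dominating T) D -> (#|D| + n = d)%N.
  by move=> D E Dmin Emin; apply/eqP; rewrite -(eqn_add2r n) !card.
move=> Dmin; apply/eqP; rewrite eqn_leq -{1}sn (depth_origin_le Dmin sreg) /=.
have Dm : {in D, forall j, 'X_j \in m0} by move=> j _; rewrite mem_coord_prime inE.
have [p [pch Dp pm]] := spec_chain (@origin_maximal K d) Dm.
have /nmax : exists p, primes_between I m0 p #|~: D|.
  exists p; split=> // a aI; apply: Dp; apply: closed_nbhd_ideal_sub aI.
  by case/minsetP: Dmin.
rewrite (cardsCs (~: D)) setCK card_ord => h.
by rewrite -leq_subLR.
Qed.

Section StarPacking.
Variables (L : {set 'I_d}) (p : 'I_d -> 'I_d).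
Hypothesis Lp : star_packing T L p.

Let F l : R := mono K (N l).
Let L2 := [set l in L | p l != l].
Let z l : R := 'X_l - 'X_(p l).

(** [p] maps [L2] bijectively onto the complement of [L]. *)
Lemma star_packing_card : (#|L| + #|L2| = d)%N.
Proof.
have [NL disj cov] := Lp.
have pN l : l \in L -> p l \in N l by move=> lL; rewrite NL // !inE eqxx orbT.
have L2L l : l \in L2 -> l \in L by rewrite inE => /andP[].
have -> : #|L2| = #|~: L|; last by rewrite cardsC card_ord.
have -> : ~: L = p @: L2.
  apply/setP => i; rewrite inE; apply/idP/imsetP => [iL|[l lL2 ->]].
    have [l lL [il _]] := cov i; exists l.
      rewrite inE lL; apply: contraNneq iL => pl.
      by move: il; rewrite NL // pl !inE orbb => /eqP->.
    by move: il; rewrite NL // !inE => /orP[]/eqP il //; rewrite il lL in iL.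
  apply/negP => plL; move: (lL2); rewrite inE => /andP[lL /eqP]; apply.
  by apply: (disjoint_index disj plL lL (x := p l)); rewrite ?closed_nbhdxx ?pN.
rewrite card_in_imset // => l l' lL2 l'L2 e.
by apply: (disjoint_index disj (x := p l)); rewrite ?L2L // ?pN ?L2L // e pN ?L2L.
Qed.

(* The polynomial ring as a polynomial ring in ['X_l] over the polynomials in [z l]
   and the other variables, and vice versa. *)
Let tauF l (j : 'I_d) : {poly R} :=
  if j == l then 'X else if j == p l then 'X - (z l)%:P else ('X_j)%:P.
Let tauG l (j : 'I_d) : {poly R} :=
  if j == p l then ('X_l)%:P - 'X else ('X_j)%:P.

Lemma tauFK l a : (polyval (tauF l) a).['X_l] = a.
Proof.
apply: horner_polyval => j; rewrite /tauF; case: eqP => [->|_]; first by rewrite hornerX.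
case: eqP => [->|_]; last by rewrite hornerC.
by rewrite hornerD hornerN hornerX hornerC /z subKr.
Qed.

Lemma tauGK l a : (polyval (tauG l) a).[z l] = a.
Proof.
apply: horner_polyval => j; rewrite /tauG; case: eqP => [->|_]; last by rewrite hornerC.
by rewrite hornerD hornerN hornerX hornerC /z subKr.
Qed.

Lemma polyvalB (h : 'I_d -> {poly R}) a b :
  polyval h (a - b) = polyval h a - polyval h b.
Proof. exact: rmorphB. Qed.

Lemma univariate_const (h : 'I_d -> {poly R}) g y :
  polyval h y = y%:P -> polyval h (univariate g y) = (univariate g y)%:P.
Proof.
move=> hy; pose f := (polyval h : {rmorphism R -> {poly R}}).
pose C := (@polyC R : {rmorphism R -> {poly R}}).
have e1 := rmorph_univariate f g y; have e2 := rmorph_univariate C g y.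
transitivity (f (univariate g y)) => //; transitivity (C (univariate g y)) => //.
rewrite e1 e2; apply: (congr2 (@horner _)) hy; apply: eq_map_poly => c.
exact: polyvalC.
Qed.

Let Ldisj l k j : l \in L -> k \in L -> k != l -> j \in N k -> (j != l) && (j != p l).
Proof.
have [NL disj _] := Lp => lL kL kl jk.
have jl : j \notin N l.
  by apply: contra kl => jl; apply/eqP; apply: (disjoint_index disj kL lL jk jl).
by move: jl; rewrite NL // !inE negb_or.
Qed.

Let pN l : l \in L -> p l \in N l.
Proof. by have [NL _ _] := Lp => lL; rewrite NL // !inE eqxx orbT. Qed.

Let tauF_const l j : j != l -> j != p l -> polyval (tauF l) 'X_j = ('X_j)%:P.
Proof. by move=> jl jp; rewrite polyvalX /tauF (negPf jl) (negPf jp). Qed.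

Let tauG_const l j : j != p l -> polyval (tauG l) 'X_j = ('X_j)%:P.
Proof. by move=> jp; rewrite polyvalX /tauG (negPf jp). Qed.

Lemma tauF_G l k g : l \in L -> k \in L2 ->
  polyval (tauF l) (univariate g (z k)) = (univariate g (z k))%:P.
Proof.
rewrite inE => lL /andP[kL pk]; apply: univariate_const.
rewrite /z polyvalB; have [kl|kl] := eqVneq k l.
  by rewrite !polyvalX /tauF -kl eqxx (negPf pk) eqxx subKr.
have /andP[k1 k2] := Ldisj lL kL kl (closed_nbhdxx T k).
have /andP[k3 k4] := Ldisj lL kL kl (pN kL).
by rewrite (tauF_const k1 k2) (tauF_const k3 k4) polyCB.
Qed.

Lemma tauF_F l k : l \in L -> k \in L -> k != l ->
  polyval (tauF l) (F k) = (F k)%:P.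
Proof.
move=> lL kL kl; rewrite /F /mono !rmorph_prod; apply: eq_bigr => j jk /=.
by have /andP[j1 j2] := Ldisj lL kL kl jk; rewrite tauF_const.
Qed.

Lemma tauF_monic l : l \in L -> polyval (tauF l) (F l) \is monic.
Proof.
have [NL _ _] := Lp => lL; rewrite /F /mono NL //.
have [pl|pl] := eqVneq (p l) l.
  rewrite pl; have -> : [set l; l] = [set l] by apply/setP => j; rewrite !inE orbb.
  by rewrite big_set1 polyvalX /tauF eqxx monicX.
rewrite big_setU1 ?inE 1?eq_sym //= big_set1 rmorphM /= !polyvalX /tauF eqxx.
by rewrite (negPf pl) eqxx monicMl ?monicX // monicXsubC.
Qed.

Lemma tauG_G l k g : l \in L2 -> k \in L2 -> k != l ->
  polyval (tauG l) (univariate g (z k)) = (univariate g (z k))%:P.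
Proof.
rewrite !inE => /andP[lL pl] /andP[kL pk] kl; apply: univariate_const.
have /andP[_ k2] := Ldisj lL kL kl (closed_nbhdxx T k).
have /andP[_ k4] := Ldisj lL kL kl (pN kL).
by rewrite /z polyvalB (tauG_const k2) (tauG_const k4) polyCB.
Qed.

Lemma tauG_monic l g : l \in L2 -> g \is monic ->
  polyval (tauG l) (univariate g (z l)) \is monic.
Proof.
rewrite inE => /andP[lL pl] gmon.
pose f := (polyval (tauG l) : {rmorphism R -> {poly R}}).
have -> : polyval (tauG l) (univariate g (z l))
    = (map_poly (polyval (tauG l) \o @mpolyC d K) g).[polyval (tauG l) (z l)]
  := rmorph_univariate f g (z l).
have -> : polyval (tauG l) (z l) = 'X.
  rewrite /z polyvalB tauG_const 1?eq_sym // polyvalX /tauG eqxx.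
  by rewrite subKr.
have -> : map_poly (polyval (tauG l) \o @mpolyC d K) g
    = (map_poly (@mpolyC d K) g)^:P.
  by rewrite -map_poly_comp; apply: eq_map_poly => c /=; rewrite polyvalC.
by rewrite -[_.['X]]/(_ \Po 'X) comp_polyXr; apply: monic_map.
Qed.

Lemma ideal_span_cat (A : comNzRingType) (s t : seq A) a : a \in ideal_span (s ++ t) ->
  exists2 y, y \in ideal_span s & a - y \in ideal_span t.
Proof.
elim/last_ind: t a => [|t x IH] a.
  by rewrite cats0 => aS; exists a; rewrite // subrr ideal_span0.
rewrite -rcons_cat => /ideal_span_rcons[c /IH[y ys yt]]; exists y => //.
by apply/ideal_span_rcons; exists c; rewrite addrAC.
Qed.

Section RegularParameters.
Variable m : prime_idealr R.
Hypotheses (Im : {subset I <= m}) (mmax : maximal_ideal m).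

(** The sequence consists of monic polynomials in the [z l] that lie in [m], given by Zariski's
    lemma. *)
Lemma star_packing_locally_regular : exists2 s, size s = #|L2| & locally_regular I m s.
Proof.
have /fin_all_exists[g gP] (l : 'I_d) : exists g : {poly K},
    g \is monic /\ univariate g (z l) \in m.
  by have [g gmon gm] := zariski mmax (z l); exists g.
pose G l := univariate (g l) (z l).
exists [seq G l | l <- enum L2]; first by rewrite size_map -cardE.
split=> [_ /mapP[l _ ->]|i]; first by case: (gP l).
rewrite size_map => lti.
have l0 : 'I_d by case: (enum L2) lti => [|x _ _] //; exact: x.
rewrite (nth_map l0) //; set l := nth l0 (enum L2) i.
have lL2 : l \in L2 by rewrite -mem_enum mem_nth.
have before k : k \in take i (enum L2) -> k \in L2 /\ k != l.
  move=> ki; split; first by rewrite -mem_enum; apply: mem_take ki.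
  have := enum_uniq L2; rewrite -{1}(cat_take_drop i (enum L2)) cat_uniq.
  case/and3P => _ /hasPn dis _; apply: contraTneq ki => ->; apply: dis.
  by rewrite (drop_nth l0 lti) inE eqxx.
(* The generators of the ideal are adjoined one at a time. With none, [G l] is monic in [z l] and
   the earlier elements are constant; each new [F k] is monic in ['X_k], all else being constant. *)
have reg ls : uniq ls -> {subset ls <= L} ->
    regular_mod (ideal_span (take i [seq G l | l <- enum L2] ++ [seq F l | l <- ls])) (G l).
  rewrite -map_take; elim/last_ind: ls => [_ _|ls k IH].
    rewrite cats0; apply: (monic_regular (tauGK l)).
      by apply: tauG_monic => //; case: (gP l).
    by move=> _ /mapP[k /before[kL2 kl] ->]; apply: tauG_G.
  rewrite rcons_uniq map_rcons -rcons_cat => /andP[kls uls] lsL.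
  have kL : k \in L by apply: lsL; rewrite mem_rcons inE eqxx.
  have lsL' : {subset ls <= L} by move=> j jls; apply: lsL; rewrite mem_rcons inE jls orbT.
  apply: (regular_rcons_monic (tauFK k)).
  - exact: tauF_monic.
  - move=> b; rewrite mem_cat => /orP[/mapP[j /before[jL2 _] ->]|/mapP[j jls ->]].
      exact: tauF_G.
    by apply: tauF_F => //; [exact: lsL' | apply: contraNneq kls => <-].
  - exact: tauF_G.
  exact: IH.
have Lsub : {subset enum L <= L} by move=> j; rewrite mem_enum.
have := reg (enum L) (enum_uniq L) Lsub; set t := take i _ => {}reg a.
have IE := @star_packing_span K d T L p Lp.
move=> /saturationP[u [y [um yt]]]; rewrite IE => e.
have : G l * (u * a) \in ideal_span (t ++ [seq F l | l <- enum L]).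
  have -> : G l * (u * a) = u * (G l * a) - y + y by ring.
  have cl := @ideal_span_closed _ (t ++ [seq F l | l <- enum L]).
  apply: (ideal_closedD cl); [move: e|move: yt];
    by apply: ideal_span_sub => b bt; rewrite mem_cat bt ?orbT.
move=> /reg/ideal_span_cat[y' y't e']; apply/saturationP; exists u, y'.
by rewrite IE.
Qed.

(** The prime [m] contains a variable from each [N l]. These [#|L|] variables form a dominating set,
    above whose prime [spec_chain] finds a chain of length [d - #|L|]. *)
Lemma star_packing_prime_chain : exists q, primes_between I m q #|L2|.
Proof.
have [NL disj cov] := Lp.
have [|f fN fm] := @transversal_exists _ N L [set j | 'X_j \in m].
  move=> l lL; have : F l \in m by apply/Im/mono_closed_nbhd_ideal.
  apply: contraTneq => E0; rewrite /F /mono.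
  elim/big_rec: _ => [|j a jl am]; first by rewrite idealr1.
  rewrite prime_idealrM negb_or am andbT; apply/negP => jm.
  by move/setP: E0 => /(_ j); rewrite in_setI inE jm jl inE.
have cD : #|~: (f @: L)| = #|L2|.
  rewrite cardsCs setCK card_ord card_in_imset; last exact: (transversal_inj disj).
  by rewrite -[X in (X - _)%N]star_packing_card addKn.
have Dm : {in f @: L, forall j, 'X_j \in m}.
  by move=> j /(subsetP fm); rewrite inE.
have [q [qch Dq qm]] := spec_chain mmax Dm; rewrite -cD; exists q; split=> //.
move=> a aI; apply: Dq; apply: closed_nbhd_ideal_sub aI.
apply/dominatingP => i; have [l lL [_ li]] := cov i.
by exists (f l); [exact: imset_f | exact: (subsetP li _ (fN _ lL))].
Qed.

End RegularParameters.

Lemma star_packing_cohen_macaulay : cohen_macaulay_ideal (closed_nbhd_ideal K T).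
Proof.
apply/cohen_macaulay_idealP => m Im mmax.
have [reg _] := @star_packing_regular K d T L p Lp.
have fl := span_flag reg.
have IE := @star_packing_span K d T L p Lp.
(* A flag above the ideal prolongs the regular sequence of its [#|L|] generators, so at most
   [d - #|L| = #|L2|] steps remain. This bounds depth and dimension alike. *)
have bound s J J' : {subset I <= J} -> regular_flag J s J' -> 1 \notin J' ->
    (size s <= #|L2|)%N.
  move=> IJ flJ J1; have sub : {subset ideal_span [seq F l | l <- enum L] <= J}.
    by move=> a; rewrite -IE; apply: IJ.
  have := flag_bound fl sub flJ (ideal_span0 _) J1.
  by rewrite -[X in (_ <= X)%N]star_packing_card size_map -cardE leq_add2l.
exists #|L2|; split; first exact: star_packing_locally_regular.
- move=> _ [s <- sreg]; apply: bound (locally_regular_flag sreg) _.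
    by apply: sub_saturation; apply: ideal_span0.
  exact: locally_regular_proper.
- exact: star_packing_prime_chain.
move=> n [q [qch Iq qm]]; have [s <- flq] := chain_flag qch.
by apply: bound Iq flq _; rewrite idealr1.
Qed.

End StarPacking.
End Equivalences.

Theorem corollary3p13 (d : nat) (T : rel 'I_d) (treeT : tree T)
    (K : fieldType) :
  [<-> domination_unmixed T;
       unmixed (closed_nbhd_ideal K T);
       cohen_macaulay_ideal (closed_nbhd_ideal K T);
       complete_intersection (closed_nbhd_ideal K T)]
  /\ (forall L : fieldType,
        cohen_macaulay_ideal (closed_nbhd_ideal K T)
        <-> cohen_macaulay_ideal (closed_nbhd_ideal L T)).
Proof.
have [_ [Tsym Tirr] _ Tacyc] := treeT.
have CM_unm F : cohen_macaulay_ideal (closed_nbhd_ideal F T) -> domination_unmixed T.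
  exact: cohen_macaulay_domination.
have unm_CM F : domination_unmixed T -> cohen_macaulay_ideal (closed_nbhd_ideal F T).
  move=> /(unmixed_star_packing Tsym Tirr Tacyc)[L [p Lp]].
  exact: star_packing_cohen_macaulay Lp.
(* Independence of the field: the property is equivalent to one of [T] alone. *)
split; last by move=> L; split=> /CM_unm/unm_CM; apply.
tfae.
- by move/unmixed_domination.
- by move/unmixed_domination/unm_CM.
- move/CM_unm/(unmixed_star_packing Tsym Tirr Tacyc) => [L [p Lp]].
  exists [seq mono K (closed_nbhd T l) | l <- enum L].
    exact: star_packing_regular Lp.
  exact: star_packing_span Lp.
- exact: complete_intersection_domination.
Qed.
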